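(* For every $k\in\mathbb{N}$, every $\epsilon>0$ and every $k$-uniform directed hypergraph $F$ there is a constant $\delta_2=\delta_2(k,\epsilon,F)>0$ such that the following holds. For every $k$-uniform directed hypergraph $G$ with vertex set $V(G)$ and $t(F,G)\leq\delta_2$ there is a subset $S\subseteq G$ with $|S|\leq\epsilon |V(G)|^k$ such that $t(F,G\setminus S)=0$ and moreover ${\rm Aut}(G)\subseteq {\rm Aut}(G\setminus S)$.
   Context: A directed $k$-uniform hypergraph $H$ on a finite vertex set $V$ is a subset of $V^k$ consisting of $k$-tuples with no repeated coordinates; its elements are called edges. A homomorphism from a directed $k$-uniform hypergraph $F$ (vertex set $V(F)$) to $H$ (vertex set $V(H)$) is a map $f:V(F)\to V(H)$ such that $(f(a_1),\dots,f(a_k))\in H$ whenever $(a_1,\dots,a_k)\in F$. The automorphism group ${\rm Aut}(H)$ is the group of bijective homomorphisms $V(H)\to V(H)$ from $H$ to itself. The homomorphism density $t(F,G)$ is the probability that a uniformly random map $f:V(F)\to V(G)$ is a homomorphism from $F$ to $G$. For $S\subseteq G$, $G\setminus S$ is the hypergraph on $V(G)$ with edge set $G\setminus S$. *)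

(* Defs.v *)
From mathcomp Require Import all_boot all_fingroup all_order all_algebra.
From mathcomp Require Import reals.

Set Implicit Arguments.
Unset Strict Implicit.
Unset Printing Implicit Defensive.

Import GroupScope GRing.Theory Num.Theory.
Local Open Scope ring_scope.

Definition dhypergraph (k : nat) (V : finType) (H : {set k.-tuple V}) : Prop :=
  forall e : k.-tuple V, e \in H -> uniq e.

Definition dhom (k : nat) (V W : finType) (F : {set k.-tuple V})
    (H : {set k.-tuple W}) (f : V -> W) : bool :=
  [forall a in F, map_tuple f a \in H].

(* Bijective self-maps of the finite type V are exactly {perm V}. *)
Definition dhAut (k : nat) (V : finType) (H : {set k.-tuple V}) :
    {set {perm V}} :=
  [set s : {perm V} | dhom H H s].

Lemma dhAut_group_set (k : nat) (V : finType) (H : {set k.-tuple V}) :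
  group_set (dhAut H).
Proof.
apply/group_setP; split=> [|s u]; rewrite !inE.
  apply/forall_inP => a aH; suff -> : map_tuple (1%g : {perm V}) a = a by [].
  by apply: val_inj; rewrite /= -[RHS]map_id; apply: eq_map => x; rewrite perm1.
move=> /forall_inP hs /forall_inP hu; apply/forall_inP => a aH.
suff -> : map_tuple (s * u)%g a = map_tuple u (map_tuple s a) by exact/hu/hs.
by apply: val_inj; rewrite /= -map_comp; apply: eq_map => x; rewrite permM.
Qed.

Canonical dhAut_group (k : nat) (V : finType) (H : {set k.-tuple V}) :=
  Group (dhAut_group_set H).

(* If V is inhabited and W is empty there are no maps at all, and the density
   is 0 / 0 = 0. *)
Definition hom_density (R : realType) (k : nat) (V W : finType)
    (F : {set k.-tuple V}) (G : {set k.-tuple W}) : R :=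
  #|[set f : {ffun V -> W} | dhom F G f]|%:R / #|{: {ffun V -> W}}|%:R.

(* Main.v *)
Require Import Defs.
From mathcomp Require Import all_boot all_fingroup all_order all_algebra.
From mathcomp Require Import reals.
From mathcomp Require Import boolp ring lra zify.
Set Implicit Arguments.
Unset Strict Implicit.
Unset Printing Implicit Defensive.
Import Order.TTheory GRing.Theory Num.Theory.
Local Open Scope ring_scope.

(** If removing [S] destroys all copies of [F], then so does removing the edges
    whose orbit under [Aut G] meets [S] in a proportion at least [1 / #|F|]: a
    copy of [F] avoiding these edges has, by the union bound, a translate that
    avoids [S].  This set is invariant and at most [#|F|] times larger than [S],
    so the ordinary removal lemma suffices.

    For the latter, regard maps [V(F) -> V(G)] as points [x] of a product space
    and colour, for each [g] of size [k], the projection of [x] to the coordinates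
    in [g] by the edges of [F] on [g] that [x] maps into [G].  Going down from
    level [k] to level 0, a strong regularity lemma (energy increment, with a
    coarse and a fine partition) makes the colours of level [d.+1] nearly constant
    in density, up to a small L2 deviation and a uniform error, on the cells of
    the colours of level [d].  Points in sparse cells, or in cells where the L2
    deviation is large, are rare; the edges below them are removed.  For a
    remaining point, a counting lemma bounds from below the number of points
    with the same colours as [x], each of which is a copy of [F] in [G].  In the
    counting lemma the L2 deviation is handled by Cauchy-Schwarz, which glues two
    copies of the complex of lower-dimensional faces along one edge: hence the
    lemma is stated for all complexes over the vertex set of [F]. *)

(** * Averages and conditional expectations *)

Section Average.
Variable R : realType.

(** On an empty type this is [0 / 0 = 0], so averaging a constant requires a point of the type. *)
Definition avg (T : finType) (f : T -> R) : R := (\sum_x f x) / #|T|%:R.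

Lemma eq_avg (T : finType) (f g : T -> R) : f =1 g -> avg f = avg g.
Proof. by move=> fg; congr (_ / _); apply: eq_bigr. Qed.


Lemma avgD (T : finType) (f g : T -> R) :
  avg (fun x => f x + g x) = avg f + avg g.
Proof. by rewrite /avg big_split /= mulrDl. Qed.

Lemma avgZ (T : finType) (c : R) (f : T -> R) :
  avg (fun x => c * f x) = c * avg f.
Proof. by rewrite /avg -mulr_sumr mulrA. Qed.

Lemma avgZr (T : finType) (c : R) (f : T -> R) :
  avg (fun x => f x * c) = avg f * c.
Proof. by rewrite mulrC -avgZ; apply: eq_avg => x; rewrite mulrC. Qed.

Lemma avgB (T : finType) (f g : T -> R) :
  avg (fun x => f x - g x) = avg f - avg g.
Proof. by rewrite /avg sumrB mulrBl. Qed.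

Lemma avg_sum (T I : finType) (P : pred I) (F : I -> T -> R) :
  avg (fun x => \sum_(i | P i) F i x) = \sum_(i | P i) avg (F i).
Proof. by rewrite /avg exchange_big /= mulr_suml. Qed.

Lemma avg_exchange (T U : finType) (F : T -> U -> R) :
  avg (fun x => avg (F x)) = avg (fun y => avg (F^~ y)).
Proof.
rewrite /avg -!mulr_suml exchange_big /= -!mulrA; congr (_ * _).
exact: mulrC.
Qed.

Lemma ler_avg (T : finType) (f g : T -> R) :
  (forall x, f x <= g x) -> avg f <= avg g.
Proof.
by move=> fg; rewrite /avg ler_wpM2r ?invr_ge0 ?ler0n// ler_sum.
Qed.

Lemma avg_ge0 (T : finType) (f : T -> R) : (forall x, 0 <= f x) -> 0 <= avg f.
Proof. by move=> f0; rewrite /avg mulr_ge0 ?invr_ge0 ?ler0n ?sumr_ge0. Qed.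

Lemma avg_cst (T : finType) (x0 : T) (c : R) : avg (fun _ : T => c) = c.
Proof.
rewrite /avg sumr_const -(mulr_natr c) mulfK// pnatr_eq0 -lt0n.
by apply/card_gt0P; exists x0.
Qed.

Lemma avg_norm (T : finType) (f : T -> R) : `|avg f| <= avg (fun x => `|f x|).
Proof.
rewrite /avg normrM [X in _ * X]ger0_norm ?invr_ge0 ?ler0n//.
by rewrite ler_wpM2r ?invr_ge0 ?ler0n// ler_norm_sum.
Qed.

Lemma avg_bij (T U : finType) (h : T -> U) (F : U -> R) :
  bijective h -> avg F = avg (fun x => F (h x)).
Proof.
move=> bh; rewrite /avg (bij_eq_card bh); congr (_ / _).
by apply: reindex; apply: onW_bij.
Qed.

Lemma avg_prod (T U : finType) (F : T -> U -> R) :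
  avg (fun p : T * U => F p.1 p.2) = avg (fun x => avg (F x)).
Proof.
rewrite /avg card_prod natrM invfM -pair_bigA /= -mulr_suml -mulrA.
by congr (_ * _); rewrite mulrC.
Qed.

(** Lagrange's identity: the two sides differ by half the average of [(f x * g y - f y * g x) ^+ 2]
    over all pairs. *)
Lemma avg_CauchySchwarz (T : finType) (f g : T -> R) :
  avg (fun x => f x * g x) ^+ 2 <=
  avg (fun x => f x ^+ 2) * avg (fun x => g x ^+ 2).
Proof.
suff -> : avg (fun x => f x * g x) ^+ 2 =
  avg (fun x => f x ^+ 2) * avg (fun x => g x ^+ 2) -
  2^-1 * avg (fun x => avg (fun y => (f x * g y - f y * g x) ^+ 2)).
  rewrite gerBl mulr_ge0 ?invr_ge0 ?ler0n// avg_ge0// => x.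
  by apply: avg_ge0 => y; apply: sqr_ge0.
have -> : avg (fun x => avg (fun y => (f x * g y - f y * g x) ^+ 2)) =
  avg (fun x => avg (fun y => f x ^+ 2 * g y ^+ 2)) +
  (avg (fun x => avg (fun y => f y ^+ 2 * g x ^+ 2)) -
  2 * avg (fun x => avg (fun y => f x * g x * (f y * g y)))).
  rewrite -avgZ -avgB -avgD; apply: eq_avg => x.
  rewrite -avgZ -avgB -avgD; apply: eq_avg => y; ring.
have -> : avg (fun x => avg (fun y => f y ^+ 2 * g x ^+ 2)) =
   avg (fun x => f x ^+ 2) * avg (fun x => g x ^+ 2).
  by under eq_avg do rewrite avgZr; rewrite avgZ.
have -> : avg (fun x => avg (fun y => f x ^+ 2 * g y ^+ 2)) =
   avg (fun x => f x ^+ 2) * avg (fun x => g x ^+ 2).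
  by under eq_avg do rewrite avgZ; rewrite avgZr.
have -> : avg (fun x => avg (fun y => f x * g x * (f y * g y))) =
   avg (fun x => f x * g x) ^+ 2.
  by under eq_avg do rewrite avgZ; rewrite avgZr expr2.
by field.
Qed.

Definition indic (b : bool) : R := b%:R.

Lemma indic_ge0 (b : bool) : 0 <= indic b. Proof. exact: ler0n. Qed.
Lemma indic_le1 (b : bool) : indic b <= 1. Proof. by case: b; rewrite /indic ?ler01. Qed.
Lemma indicM (a b : bool) : indic (a && b) = indic a * indic b.
Proof. by rewrite /indic -mulnb natrM. Qed.

Lemma ler_indic (a b : bool) : (a -> b) -> indic a <= indic b.
Proof. by move=> ab; rewrite /indic ler_nat; case: a ab => [->|]. Qed.

End Average.

Section CondExp.
Variables (R : realType) (T : finType) (L : eqType).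
Implicit Types (l : T -> L) (f : T -> R).

(** Conditional expectation given the level sets of [l]. The cell of [x] contains [x], so the
    denominator is positive. *)
Definition cexp l f x : R :=
  avg (fun y => f y * indic R (l y == l x)) / avg (fun y => indic R (l y == l x)).

Lemma eq_cexp l f x y : l x = l y -> cexp l f x = cexp l f y.
Proof. by rewrite /cexp => ->. Qed.

Lemma avg_cell_gt0 l x : 0 < avg (fun y => indic R (l y == l x)).
Proof.
rewrite /avg mulr_gt0 ?invr_gt0 ?ltr0n//; last by apply/card_gt0P; exists x.
rewrite (bigD1 x)//= eqxx ltr_pwDl// ?ltr01// sumr_ge0// => y _.
Qed.

Lemma cexp_cell l f x :
  cexp l f x * avg (fun y => indic R (l y == l x)) =
  avg (fun y => f y * indic R (l y == l x)).
Proof. by rewrite /cexp mulfVK// gt_eqF// avg_cell_gt0. Qed.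

Lemma cexp_ge0 l f x : (forall y, 0 <= f y) -> 0 <= cexp l f x.
Proof.
move=> f0; rewrite /cexp divr_ge0// avg_ge0// => y; rewrite ?indic_ge0//.
by rewrite mulr_ge0 ?indic_ge0.
Qed.

Lemma cexp_le1 l f x : (forall y, f y <= 1) -> cexp l f x <= 1.
Proof.
move=> f1; rewrite /cexp ler_pdivrMr ?avg_cell_gt0// mul1r.
apply: ler_avg => y; rewrite -[leRHS]mul1r ler_wpM2r ?indic_ge0//.
Qed.

(** Averaging over cells has a kernel symmetric in [x] and [y], hence is self-adjoint, and it fixes
    functions that are constant on the cells. *)
Lemma avg_cexp l f (h : T -> R) : (forall x y, l x = l y -> h x = h y) ->
  avg (fun x => cexp l f x * h x) = avg (fun x => f x * h x).
Proof.
move=> hl.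
transitivity (avg (fun x => avg (fun y =>
   f y * h y * indic R (l y == l x) / avg (fun z => indic R (l z == l y))))).
  apply: eq_avg => x; rewrite /cexp.
  rewrite -mulrA -avgZr; apply: eq_avg => y.
  case: eqP => [e|_]; last by rewrite /indic !(mulr0, mul0r).
  by rewrite (hl y x e) e; ring.
rewrite avg_exchange; apply: eq_avg => y.
transitivity (avg (fun x => indic R (l x == l y)) *
  (f y * h y / avg (fun z => indic R (l z == l y)))).
  by rewrite -avgZr; apply: eq_avg => x; rewrite eq_sym; ring.
by rewrite mulrC mulfVK// gt_eqF// avg_cell_gt0.
Qed.

Lemma avg_cexp1 l f : avg (cexp l f) = avg f.
Proof.
have := @avg_cexp l f (fun=> 1) (fun _ _ _ => erefl).
by under eq_avg do rewrite mulr1; under [in RHS]eq_avg do rewrite mulr1.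
Qed.


End CondExp.

(** Pythagoras: [l'] refines [l], so the coarse expectation is a projection of the fine one and the
    cross term is the coarse square. *)
Lemma avg_sqr_cexpB (R : realType) (T : finType) (L L' : eqType)
    (l : T -> L) (l' : T -> L') (f : T -> R) :
  (forall x y, l' x = l' y -> l x = l y) ->
  avg (fun x => (cexp l' f x - cexp l f x) ^+ 2) =
  avg (fun x => cexp l' f x ^+ 2) - avg (fun x => cexp l f x ^+ 2).
Proof.
move=> ll'.
have e1 : avg (fun x => cexp l' f x * cexp l f x) = avg (fun x => cexp l f x ^+ 2).
  rewrite avg_cexp => [|x y /ll' e]; last exact: eq_cexp.
  by rewrite -(avg_cexp (l := l) f (h := cexp l f))// => x y; apply: eq_cexp.
transitivity (avg (fun x => cexp l' f x ^+ 2) + avg (fun x => cexp l f x ^+ 2)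
  - 2 * avg (fun x => cexp l' f x * cexp l f x)); last by rewrite e1; ring.
by rewrite -avgZ -avgD -avgB; apply: eq_avg => x; ring.
Qed.

(** * Local functions on product spaces *)

Definition meas (J V : finType) (T : Type) (g : {set J})
    (F : {ffun J -> V} -> T) : Prop :=
  forall x y : {ffun J -> V}, {in g, x =1 y} -> F x = F y.

Section Swap.
Variables (R : realType) (V K J : finType) (pi : K -> J) (f : {set K}).
Hypothesis pi_inj : {in f &, injective pi}.
Implicit Types (x : {ffun J -> V}) (y : {ffun K -> V}).

(* [push] and [back] are the two components of the involution of the pairs
   [(x, y)] that exchanges the coordinates in [f] with those in [pi @: f]. *)
Definition push x y : {ffun J -> V} :=
  [ffun j => if [pick k in f | pi k == j] is Some k then y k else x j].

Definition back x y : {ffun K -> V} :=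
  [ffun k => if k \in f then x (pi k) else y k].

Lemma push_in x y k : k \in f -> push x y (pi k) = y k.
Proof.
move=> kf; rewrite ffunE; case: pickP => [k' /andP[k'f /eqP e]|/(_ k)].
  by rewrite (pi_inj k'f kf e).
by rewrite kf eqxx.
Qed.

Lemma push_out x y j : j \notin pi @: f -> push x y j = x j.
Proof.
move=> jf; rewrite ffunE; case: pickP => [k' /andP[k'f /eqP e]|//].
by case/negP: jf; rewrite -e imset_f.
Qed.

Lemma push_swap x y : push (push x y) (back x y) = x.
Proof.
apply/ffunP => j; have [/imsetP[k kf ->]|jf] := boolP (j \in pi @: f).
  by rewrite push_in// ffunE kf.
by rewrite !push_out.
Qed.

Lemma back_swap x y : back (push x y) (back x y) = y.
Proof.
apply/ffunP => k; rewrite ffunE; case: ifPn => kf; first by rewrite push_in.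
by rewrite ffunE (negPf kf).
Qed.

Lemma avg_swap (Psi : {ffun K -> V} -> {ffun J -> V} -> R) :
  avg (fun y => avg (Psi y)) =
  avg (fun y => avg (fun x => Psi (back x y) (push x y))).
Proof.
rewrite -!avg_prod.
rewrite (avg_bij (h := fun p => (back p.2 p.1, push p.2 p.1)))//.
exists (fun p => (back p.2 p.1, push p.2 p.1)) => -[y x] /=;
  by rewrite push_swap back_swap.
Qed.

(** As [pi] is injective on [f], the coordinates of [push x0 y] in [pi @: f] are uniform when [y]
    is, and [phi] sees no others. *)
Lemma avg_push (phi : {ffun J -> V} -> R) x0 (v0 : V) :
  meas (pi @: f) phi -> avg (fun y => phi (push x0 y)) = avg phi.
Proof.
move=> mphi.
transitivity (avg (fun y : {ffun K -> V} => avg phi)); last by rewrite (avg_cst [ffun=> v0]).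
rewrite (avg_swap (fun _ => phi)); apply: eq_avg => y.
rewrite -[LHS](avg_cst x0); apply: eq_avg => x; apply: mphi => _ /imsetP[k kf ->].
by rewrite !push_in.
Qed.

End Swap.

Section Mix.
Variables (R : realType) (V K : finType).
Implicit Types (e : {set K}) (y : {ffun K -> V}).

Definition mix e y y' : {ffun K -> V} := [ffun k => if k \in e then y k else y' k].

Lemma avg_mix e (Phi : {ffun K -> V} -> R) (v0 : V) :
  avg (fun y => avg (fun y' => Phi (mix e y y'))) = avg Phi.
Proof.
transitivity (avg (fun y => avg (fun y' : {ffun K -> V} => Phi y))); last first.
  by apply: eq_avg => y; rewrite (avg_cst [ffun=> v0]).
rewrite -[RHS](avg_prod (fun y y' => Phi y)) -(avg_prod (fun y y' => Phi (mix e y y'))).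
rewrite [RHS](avg_bij (h := fun p => (mix e p.1 p.2, mix e p.2 p.1)))//.
exists (fun p => (mix e p.1 p.2, mix e p.2 p.1)) => -[y y'] /=;
  by congr (_, _); apply/ffunP => k; rewrite !ffunE; case: ifP => // ->.
Qed.

(** [dbl1 z] and [dbl2 e z] agree on [e] and are independent elsewhere. Indexing by [K + K] makes
    the pair one point of a product space, to which counting statements apply again. *)
Definition dbl1 (z : {ffun K + K -> V}) : {ffun K -> V} := [ffun k => z (inl k)].
Definition dbl2 e (z : {ffun K + K -> V}) : {ffun K -> V} :=
  [ffun k => if k \in e then z (inl k) else z (inr k)].

Lemma avg_dbl e (Psi : {ffun K -> V} -> {ffun K -> V} -> R) :
  avg (fun z => Psi (dbl1 z) (dbl2 e z)) =
  avg (fun y => avg (fun y' => Psi y (mix e y y'))).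
Proof.
rewrite -(avg_prod (fun y y' => Psi y (mix e y y'))).
pose h (p : {ffun K -> V} * {ffun K -> V}) : {ffun K + K -> V} :=
  [ffun s => match s with inl k => p.1 k | inr k => p.2 k end].
rewrite (avg_bij (h := h)); last first.
  exists (fun z : {ffun K + K -> V} =>
    ([ffun k => z (inl k)], [ffun k => z (inr k)])).
    by case=> y y'; rewrite /h; congr (_, _); apply/ffunP => k; rewrite !ffunE.
  by move=> z; apply/ffunP => -[k|k]; rewrite !ffunE.
apply: eq_avg => -[y y'] /=; congr Psi; apply/ffunP => k; rewrite !ffunE//.
Qed.

(** Average [L] over the coordinates outside [e], then apply Cauchy-Schwarz in those of [e]. The
    square of the inner average is an average over two independent completions, that is, over a
    doubled point. *)
Lemma avg_CauchySchwarz_dbl e (beta L : {ffun K -> V} -> R) (v0 : V) :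
  meas e beta ->
  avg (fun y => beta y * L y) ^+ 2 <=
  avg (fun y => beta y ^+ 2) * avg (fun z => L (dbl1 z) * L (dbl2 e z)).
Proof.
move=> mb.
have bmix y y' : beta (mix e y y') = beta y.
  by apply: mb => k ke; rewrite ffunE ke.
rewrite -(avg_mix e _ v0).
under eq_avg => y do under eq_avg => y' do rewrite bmix.
under eq_avg => y do rewrite avgZ.
apply: le_trans (avg_CauchySchwarz _ _) _.
rewrite ler_wpM2l//; first by apply: avg_ge0 => y; apply: sqr_ge0.
rewrite (avg_dbl e (fun y y' => L y * L y')).
rewrite -[leRHS](avg_mix e _ v0) le_eqVlt; apply/orP; left; apply/eqP.
apply: eq_avg => y; rewrite expr2 -avgZr; apply: eq_avg => y'.
rewrite -avgZ; apply: eq_avg => y''; congr (_ * L _).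
by apply/ffunP => k; rewrite !ffunE; case: ifP => // ->.
Qed.

End Mix.

(** * Strong regularity *)

Definition coloring (J V : finType) := {set J} -> {ffun J -> V} -> nat.

Definition local_coloring (J V : finType) (c : coloring J V) : Prop :=
  forall g, meas g (c g).

Definition color_bound (J V : finType) (c : coloring J V) (m : nat) : Prop :=
  forall g x, (c g x < m)%N.

Section Regularity.
Variables (R : realType) (J V : finType).
Implicit Types (q c : coloring J V) (g h : {set J}) (x y : {ffun J -> V}).

(** Colours of the facets of [g]. Padding with 0 outside [g] gives all [g] the same type of
    labels. *)
Definition bd_label q g x : {ffun J -> nat} :=
  [ffun j => if j \in g then q (g :\ j) x else 0%N].

Lemma bd_label_meas q g : local_coloring q -> meas g (bd_label q g).
Proof.
move=> mq x y xy; apply/ffunP => j; rewrite !ffunE; case: ifP => // jg.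
by apply: mq => k /setD1P[_ /xy].
Qed.

Definition color_ind c g (a : nat) x : R := indic R (c g x == a).

Definition color_den q c g a : {ffun J -> V} -> R :=
  cexp (bd_label q g) (color_ind c g a).

Lemma color_den_ge0 q c g a x : 0 <= color_den q c g a x.
Proof. by apply: cexp_ge0 => y; apply: indic_ge0. Qed.

Lemma color_den_le1 q c g a x : color_den q c g a x <= 1.
Proof. by apply: cexp_le1 => y; apply: indic_le1. Qed.

Lemma color_den_meas q c g a : local_coloring q -> meas g (color_den q c g a).
Proof. by move=> mq x y xy; apply: eq_cexp; apply: bd_label_meas. Qed.

(** Smallness in a cut norm: a test is an intersection of sets each of which ignores one coordinate
    of [g]. *)
Definition regular g (r : {ffun J -> V} -> R) (eta : R) : Prop :=
  forall F : J -> {ffun J -> V} -> bool,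
  (forall j, j \in g -> meas (g :\ j) (F j)) ->
  `|avg (fun x => r x * indic R [forall j in g, F j x])| <= eta.

Definition refines q' q : Prop := forall h x y, q' h x = q' h y -> q h x = q h y.

Definition energy q c (m : nat) : R :=
  \sum_(g : {set J}) \sum_(a < m) avg (fun x => color_den q c g a x ^+ 2).

Definition energy_max (m : nat) : R := (#|{set J}| * m)%:R.

Lemma energy_le_max q c m : energy q c m <= energy_max m.
Proof.
have -> : energy_max m = \sum_(g : {set J}) \sum_(a < m) 1.
  rewrite /energy_max; under eq_bigr do rewrite sumr_const card_ord.
  by rewrite sumr_const -mulrnA mulnC.
apply: ler_sum => g _; apply: ler_sum => a _.
rewrite /avg; have [->|T0] := posnP #|{ffun J -> V}|.
  by rewrite invr0 mulr0 ler01.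
rewrite ler_pdivrMr ?ltr0n// mul1r -sumr_const; apply: ler_sum => x _.
by rewrite expr_le1// ?color_den_ge0 ?color_den_le1.
Qed.

Lemma avg_sqr_denB q' q c g a : refines q' q ->
  avg (fun x => (color_den q' c g a x - color_den q c g a x) ^+ 2) =
  avg (fun x => color_den q' c g a x ^+ 2) - avg (fun x => color_den q c g a x ^+ 2).
Proof.
move=> rq; apply: avg_sqr_cexpB => x y e; apply/ffunP => j; rewrite !ffunE.
case: ifP => // jg; apply: rq.
by have := congr1 (fun F : {ffun J -> nat} => F j) e; rewrite !ffunE jg.
Qed.

Lemma energyB q' q c m : refines q' q ->
  energy q' c m - energy q c m = \sum_(g : {set J}) \sum_(a < m)
    avg (fun x => (color_den q' c g a x - color_den q c g a x) ^+ 2).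
Proof.
move=> rq; rewrite /energy -sumrB; apply: eq_bigr => g _.
by rewrite -sumrB; apply: eq_bigr => a _; rewrite avg_sqr_denB.
Qed.

Lemma avg_sqr_denB_le q' q c m g (a : 'I_m) : refines q' q ->
  avg (fun x => (color_den q' c g a x - color_den q c g a x) ^+ 2) <=
  energy q' c m - energy q c m.
Proof.
move=> rq; rewrite energyB//.
have pos g' (a' : 'I_m) : 0 <= avg (fun x =>
    (color_den q' c g' a' x - color_den q c g' a' x) ^+ 2).
  by apply: avg_ge0 => x; apply: sqr_ge0.
rewrite (bigD1 g)//= (bigD1 a)//= -addrA lerDl.
by rewrite addr_ge0// sumr_ge0// => g' _; rewrite sumr_ge0.
Qed.

(** Refining [q] by the sets of a test that witnesses irregularity makes the test constant on the
    new cells. The change of conditional density then correlates with the test by more than [eta],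
    and Cauchy-Schwarz turns this into an energy gain. *)
Lemma refine_step q c m M eta : 0 < eta -> local_coloring q -> color_bound q M ->
  ~ (forall g (a : 'I_m),
       regular g (fun x => color_ind c g a x - color_den q c g a x) eta) ->
  exists q', [/\ local_coloring q', color_bound q' (2 * M), refines q' q &
    energy q c m + eta ^+ 2 <= energy q' c m].
Proof.
move=> eta0 mq qM /existsNP[g] /existsNP[a] /existsNP[F] /not_implyP[mF].
move/negP; rewrite -ltNge => irr.
(* At most one [j] in [g] satisfies [g :\ j = h], so [G] attaches to each facet its own test set.
   This bit is stored as the parity of the new colour. *)
pose G h x := [forall j in g, (h == g :\ j) ==> F j x].
pose q' : coloring J V := fun h x => ((q h x).*2 + G h x)%N.
have mG h : meas h (G h).
  move=> x y xy; apply: eq_forallb => j; case: (boolP (j \in g)) => //= jg.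
  by case: eqP => //= e; apply: mF => // k; rewrite -e => /xy.
have rq : refines q' q by move=> h x y; rewrite /q'; lia.
exists q'; split => //.
- by move=> h x y xy; rewrite /q' (mq h x y xy) (mG h x y xy).
- by move=> h x; rewrite /q'; have := qM h x; case: (G h x); lia.
rewrite addrC -lerBrDr; apply: le_trans (avg_sqr_denB_le c g a rq).
set f := color_ind c g a in irr *.
have mI x y : bd_label q' g x = bd_label q' g y ->
    indic R [forall j in g, F j x] = indic R [forall j in g, F j y].
  move=> e; have FG z : [forall j in g, F j z] = [forall j in g, G (g :\ j) z].
    apply/forall_inP/forall_inP => H j jg; last first.
      by have /forall_inP/(_ j jg) := H j jg; rewrite eqxx.
    by apply/forall_inP => k kg; rewrite H// implybT.
  rewrite !FG; congr indic; apply: eq_forallb => j; case: (boolP (j \in g)) => //= jg.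
  have := congr1 (fun F : {ffun J -> nat} => odd (F j)) e.
  by rewrite !ffunE jg /q' !oddD !odd_double !addFb !oddb.
(* The test is constant on the cells of [q'], so [f] may be replaced by its conditional expectation
   there. *)
have e : avg (fun x => (f x - color_den q c g a x) * indic R [forall j in g, F j x]) =
  avg (fun x => (color_den q' c g a x - color_den q c g a x) *
    indic R [forall j in g, F j x]).
  under eq_avg do rewrite mulrBl; under [RHS]eq_avg do rewrite mulrBl.
  by rewrite !avgB (avg_cexp f mI).
rewrite e in irr; rewrite -[avg _]mulr1.
apply: (@le_trans _ _ (avg (fun x =>
  (color_den q' c g a x - color_den q c g a x) * indic R [forall j in g, F j x]) ^+ 2)).
  by rewrite -[leRHS]real_normK ?num_real// ler_sqr ?nnegrE ?normr_ge0 ?ltW.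
apply: le_trans (avg_CauchySchwarz _ _) _; rewrite ler_wpM2l//.
  by apply: avg_ge0 => x; apply: sqr_ge0.
have [x0 _|T0] := pickP {ffun J -> V}.
  rewrite -[leRHS](avg_cst x0); apply: ler_avg => x.
  by rewrite expr_le1// ?indic_ge0 ?indic_le1.
by rewrite /avg big1 ?mul0r ?ler01// => x; have := T0 x.
Qed.

Lemma refine_iter q c m M eta n : 0 < eta -> local_coloring q -> color_bound q M ->
  exists q', [/\ local_coloring q', color_bound q' (2 ^ n * M), refines q' q &
    (forall g (a : 'I_m),
       regular g (fun x => color_ind c g a x - color_den q' c g a x) eta) \/
    n%:R * eta ^+ 2 <= energy q' c m].
Proof.
move=> eta0 mq qM; elim: n => [|n [q' [mq' qM' rq' IH]]].
  exists q; split=> //; first by rewrite mul1n.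
  right; rewrite mul0r; apply: sumr_ge0 => g _; apply: sumr_ge0 => a _.
  by apply: avg_ge0 => x; apply: sqr_ge0.
have [reg|irr] := pselect (forall g (a : 'I_m),
  regular g (fun x => color_ind c g a x - color_den q' c g a x) eta).
  exists q'; split=> //; last by left.
  by move=> h x; apply: leq_trans (qM' h x) _; rewrite expnS leq_mul2r leq_pmull ?orbT.
case: IH => // IH; have [q2 [mq2 qM2 rq2 en]] := refine_step eta0 mq' qM' irr.
exists q2; split=> //.
- by rewrite expnS -mulnA.
- by move=> h x y /rq2/rq'.
right; apply: le_trans en; rewrite -natr1 mulrDl mul1r.
by rewrite lerD2r.
Qed.

(** After this many gains of [eta ^+ 2] the energy would exceed its maximum. *)
Definition reg_steps m (eta : R) : nat := Num.bound (energy_max m / eta ^+ 2).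

Lemma weak_regularity q c m M eta : 0 < eta -> local_coloring q -> color_bound q M ->
  exists q', [/\ local_coloring q', color_bound q' (2 ^ reg_steps m eta * M),
    refines q' q & forall g (a : 'I_m),
       regular g (fun x => color_ind c g a x - color_den q' c g a x) eta].
Proof.
move=> eta0 mq qM.
have [q' [mq' qM' rq' []]] := refine_iter c m (reg_steps m eta) eta0 mq qM.
  by move=> reg; exists q'.
move=> /le_trans/(_ (energy_le_max _ _ _)); rewrite leNgt => /negP[].
rewrite -ltr_pdivrMr ?exprn_gt0// archi_boundP//.
by rewrite divr_ge0 ?exprn_ge0 ?ler0n ?ltW.
Qed.

(** Bounds the number of colours after [n] rounds when the precision of each round depends on the
    bound reached before it. *)
Definition complexity_seq m (eta : nat -> R) (n : nat) : nat :=
  iter n (fun M => 2 ^ reg_steps m (eta M) * M)%N 1%N.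

(** Each round passes from [q] to a weakly regular refinement [q']. A gain below [tau] bounds the
    squared L2 distance between coarse and fine densities and ends the iteration; a larger gain is
    added to the energy. *)
Lemma strong_regularity_iter c m (tau : R) (eta : nat -> R) n :
  (forall M, 0 < eta M) ->
  (exists i q q', [/\ (i < n)%N, local_coloring q,
     color_bound q (complexity_seq m eta i), local_coloring q' &
     forall g (a : 'I_m),
       avg (fun x => (color_den q' c g a x - color_den q c g a x) ^+ 2) <= tau /\
       regular g (fun x => color_ind c g a x - color_den q' c g a x)
         (eta (complexity_seq m eta i))]) \/
  (exists q, [/\ local_coloring q, color_bound q (complexity_seq m eta n) &
     n%:R * tau <= energy q c m]).
Proof.
move=> eta0; elim: n => [|n [[i [q [q' [ltin ? ? ? ?]]]]|[q [mq qM en]]]].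
- right; exists (fun _ _ => 0%N); split=> //.
  rewrite mul0r; apply: sumr_ge0 => g _; apply: sumr_ge0 => a _.
  by apply: avg_ge0 => x; apply: sqr_ge0.
- by left; exists i, q, q'; split=> //; apply: ltnW.
have [q' [mq' qM' rq' reg]] := weak_regularity c m (eta0 (complexity_seq m eta n)) mq qM.
have [le|lt] := leP tau (energy q' c m - energy q c m); last first.
  left; exists n, q, q'; split=> // g a; split; last exact: reg.
  exact: le_trans (avg_sqr_denB_le c g a rq') (ltW lt).
right; exists q'; split=> //.
by rewrite -natr1 mulrDl mul1r; lra.
Qed.

End Regularity.

(** The energy is bounded, so a round with small gain occurs among the first [n]. The precision
    [eta M] is measured against the complexity of the coarse [q] alone, and [Mmax] is uniform in [V]
    and [c]. *)
Lemma strong_regularity (R : realType) (J : finType) (m : nat) (tau : R)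
    (eta : nat -> R) : 0 < tau -> (forall M, 0 < eta M) ->
  exists Mmax : nat, forall (V : finType) (c : coloring J V),
    exists M (q q' : coloring J V),
    [/\ (M <= Mmax)%N, local_coloring q, color_bound q M, local_coloring q' &
     forall g (a : 'I_m),
       avg (fun x => (color_den R q' c g a x - color_den R q c g a x) ^+ 2) <= tau /\
       regular g (fun x => color_ind R c g a x - color_den R q' c g a x) (eta M)].
Proof.
move=> tau0 eta0; pose n := Num.bound (energy_max R J m / tau).
exists (\max_(i < n) complexity_seq J m eta i) => V c.
have [] := strong_regularity_iter c m tau n eta0.
  case=> i [q [q' [ltin mq qM mq' H]]].
  exists (complexity_seq J m eta i), q, q'; split=> //.
  exact: (leq_bigmax (Ordinal ltin)).
case=> q [_ _ /le_trans/(_ (energy_le_max _ _ _ _))]; rewrite leNgt => /negP[].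
rewrite -ltr_pdivrMr// archi_boundP//.
by rewrite divr_ge0 ?ler0n ?ltW.
Qed.

(** * Complexes and doubling *)

(** Faces are copies of subsets of [J] through [pi]; several vertices of [K] may lie over one vertex
    of [J], as happens after doubling. *)
Definition complex (J K : finType) (pi : K -> J) (E : {set {set K}}) (d : nat) : Prop :=
  [/\ forall f f' : {set K}, f \in E -> f' \subset f -> f' \in E,
      forall f, f \in E -> {in f &, injective pi} &
      forall f, f \in E -> (#|f| <= d)%N].

Definition cell (J V K : finType) (pi : K -> J) (c : coloring J V)
    (x : {ffun J -> V}) (E : {set {set K}}) (y : {ffun K -> V}) : bool :=
  [forall f in E, c (pi @: f) (push pi f x y) == c (pi @: f) x].

Definition cnt (R : realType) (J V K : finType) (pi : K -> J) (c : coloring J V)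
    (x : {ffun J -> V}) (E : {set {set K}}) : R :=
  avg (fun y => indic R (cell pi c x E y)).

Definition wt (R : realType) (J V K : finType) (pi : K -> J)
    (dl : {set J} -> {ffun J -> V} -> R) (x : {ffun J -> V}) (E : {set {set K}}) : R :=
  \prod_(f in E) dl (pi @: f) x.

(** Unlike [bd_label], this records all proper subsets of [g] and not only the facets. *)
Definition low_label (J V : finType) (c : coloring J V) (g : {set J})
    (x : {ffun J -> V}) : {ffun {set J} -> nat} :=
  [ffun h : {set J} => if h \proper g then c h x else 0%N].

Lemma low_label_meas (J V : finType) (c : coloring J V) (g : {set J}) :
  local_coloring c -> meas g (low_label c g).
Proof.
move=> mc x y xy; apply/ffunP => h; rewrite !ffunE; case: ifP => // /proper_sub/subsetP hg.
by apply: mc => j /hg; apply: xy.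
Qed.

(** The counting lemma in dimension [d], as a predicate. It ranges over all [K] and [pi] because the
    inductive step applies it to doubled complexes; the error is relative. *)
Definition counts (R : realType) (J V : finType) (d N : nat) (eps : R)
    (c : coloring J V) (dl : {set J} -> {ffun J -> V} -> R)
    (B : {set J} -> {set {ffun J -> V}}) : Prop :=
  forall (x : {ffun J -> V}) (K : finType) (pi : K -> J) (E : {set {set K}}),
    complex pi E d -> (#|E| <= N)%N -> (forall f, f \in E -> x \notin B (pi @: f)) ->
    `|cnt R pi c x E - wt pi dl x E| <= eps * wt pi dl x E.

Section Pull.
Variables (J V K K' : finType) (pi : K -> J) (pi' : K' -> J) (i : K -> K').
Hypotheses (i_inj : injective i) (pi_i : forall k, pi' (i k) = pi k).

Lemma imset_pi_comp (f : {set K}) : pi' @: (i @: f) = pi @: f.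
Proof. by rewrite -imset_comp; apply: eq_imset => k /=. Qed.

Lemma inj_pi_comp (f : {set K}) :
  {in f &, injective pi} -> {in i @: f &, injective pi'}.
Proof.
move=> inj _ _ /imsetP[k kf ->] /imsetP[l lf ->]; rewrite !pi_i => e.
by rewrite (inj k l).
Qed.

Lemma push_comp (f : {set K}) (x : {ffun J -> V}) (z : {ffun K' -> V}) :
  {in f &, injective pi} ->
  push pi' (i @: f) x z = push pi f x [ffun k => z (i k)].
Proof.
move=> inj; apply/ffunP => j; have [/imsetP[k kf ->]|jf] := boolP (j \in pi @: f).
  rewrite push_in// ffunE -pi_i push_in ?imset_f//; exact: inj_pi_comp.
by rewrite !push_out// imset_pi_comp.
Qed.

Lemma sub_imset_preim (f : {set K}) (f' : {set K'}) :
  f' \subset i @: f -> exists2 h : {set K}, h \subset f & f' = i @: h.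
Proof.
move=> /subsetP sf; exists (i @^-1: f').
  by apply/subsetP => k; rewrite inE => /sf /imsetP[l lf /i_inj ->].
apply/setP => k'; apply/idP/imsetP => [k'f|[k]]; last by rewrite inE => ? ->.
by have /imsetP[k kf e] := sf _ k'f; exists k => //; rewrite inE -e.
Qed.

End Pull.

Section Doubling.
Variables (R : realType) (J V K : finType) (pi : K -> J) (L : {set {set K}}).
Variables (d : nat) (e : {set K}).
Hypothesis cL : complex pi L d.
Implicit Types (c : coloring J V) (dl : {set J} -> {ffun J -> V} -> R).

Definition dpi (s : K + K) : J := match s with inl k => pi k | inr k => pi k end.
Definition glue (k : K) : K + K := if k \in e then inl k else inr k.
(** Two copies of [L] sharing [e]. Faces inside [e] coincide in both copies, so the second family
    omits them. *)
Definition dcomplex : {set {set K + K}} :=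
  [set inl @: (f : {set K}) | f in L] :|:
  [set glue @: (f : {set K}) | f in [set f in L | ~~ (f \subset e)]].

Let inlI : injective (inl : K -> K + K). Proof. by move=> ? ? []. Qed.
Lemma glue_inj : injective glue.
Proof. by move=> k l; rewrite /glue; case: ifP; case: ifP => // _ _ []. Qed.
Lemma dpi_glue k : dpi (glue k) = pi k.
Proof. by rewrite /glue; case: ifP. Qed.

Lemma glue_sub (f : {set K}) : f \subset e -> glue @: f = inl @: f.
Proof. by move=> /subsetP fe; apply: eq_in_imset => k /fe; rewrite /glue => ->. Qed.

Lemma dcomplexP (f' : {set K + K}) : f' \in dcomplex ->
  exists2 f, f \in L & (f' = inl @: f \/ f' = glue @: f).
Proof.
case/setUP => /imsetP[f]; first by move=> fL ->; exists f; [|left].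
by rewrite inE => /andP[fL _] ->; exists f; [|right].
Qed.

Lemma inl_dcomplex f : f \in L -> inl @: f \in dcomplex.
Proof. by move=> fL; apply/setUP; left; apply/imsetP; exists f. Qed.

Lemma glue_dcomplex f : f \in L -> glue @: f \in dcomplex.
Proof.
move=> fL; have [fe|fe] := boolP (f \subset e).
  by rewrite glue_sub// inl_dcomplex.
by apply/setUP; right; apply/imsetP; exists f; rewrite ?inE ?fL.
Qed.

Lemma dcomplex_complex : complex dpi dcomplex d.
Proof.
have [cl inj sz] := cL; split.
- move=> f f' /dcomplexP[h hL [->|->]] sf.
    have [h' h'h ->] := sub_imset_preim inlI sf.
    by apply: inl_dcomplex; apply: cl h'h.
  have [h' h'h ->] := sub_imset_preim glue_inj sf.
  by apply: glue_dcomplex; apply: cl h'h.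
- move=> f /dcomplexP[h hL [->|->]].
    by apply: (@inj_pi_comp _ _ _ pi) => //; apply: inj.
  by apply: (@inj_pi_comp _ _ _ pi) => //; [exact: dpi_glue|apply: inj].
- move=> f /dcomplexP[h hL [->|->]].
    by rewrite card_imset//; apply: sz.
  by rewrite card_imset; [apply: sz|apply: glue_inj].
Qed.

Lemma card_dcomplex : (#|dcomplex| <= 2 * #|L|)%N.
Proof.
rewrite mul2n -addnn; apply: leq_trans (leq_card_setU _ _) _.
apply: leq_add; first exact: leq_imset_card.
apply: leq_trans (leq_imset_card _ _) _; apply: subset_leq_card.
by apply/subsetP => f; rewrite inE => /andP[].
Qed.

(** Identifies the second factor in [avg_CauchySchwarz_dbl] with a count in the doubled complex. *)
Lemma cell_dcomplex c x z :
  cell dpi c x dcomplex z = cell pi c x L (dbl1 z) && cell pi c x L (dbl2 e z).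
Proof.
have [_ inj _] := cL.
have e1 f : f \in L -> push dpi (inl @: f) x z = push pi f x (dbl1 z).
  by move=> fL; rewrite (push_comp (pi := pi))//; apply: inj.
have e2 f : f \in L -> push dpi (glue @: f) x z = push pi f x (dbl2 e z).
  move=> fL; rewrite (push_comp dpi_glue _ _ (inj f fL)).
  by congr push; apply/ffunP => k; rewrite !ffunE /glue; case: ifP.
apply/idP/andP => [/forall_inP H|[/forall_inP H1 /forall_inP H2]].
  split; apply/forall_inP => f fL.
    have := H _ (inl_dcomplex fL).
    by rewrite e1// (imset_pi_comp (pi := pi)).
  have := H _ (glue_dcomplex fL).
  by rewrite e2// (imset_pi_comp (pi := pi))//; exact: dpi_glue.
apply/forall_inP => f' /dcomplexP[f fL [->|->]].
  by rewrite e1// (imset_pi_comp (pi := pi))//; apply: H1.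
rewrite e2// (imset_pi_comp (pi := pi)); last exact: dpi_glue.
exact: H2.
Qed.

(** A glued face not contained in [e] has a vertex [inr k], so the two families are disjoint. *)
Lemma wt_dcomplex dl x : wt dpi dl x dcomplex =
  wt pi dl x L * \prod_(f in L | ~~ (f \subset e)) dl (pi @: f) x.
Proof.
rewrite /wt /dcomplex; set A := [set _ | _ in L]; set B := [set _ | _ in _].
have -> : \prod_(f in A :|: B) dl (dpi @: f) x =
    \prod_(f in [predU A & B]) dl (dpi @: f) x.
  by apply: eq_bigl => f; rewrite !inE.
rewrite bigU /=; last first.
  rewrite disjoint_subset; apply/subsetP => f' /imsetP[f fL ->].
  rewrite inE; apply/negP => /imsetP[h]; rewrite inE => /andP[hL /subsetPn[k kh ke]].
  move/setP/(_ (inr k)); rewrite {2}[inr k](_ : _ = glue k); last by rewrite /glue (negPf ke).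
  by rewrite imset_f// => /imsetP[].
rewrite big_imset /=; last by move=> f h _ _; apply: imset_inj.
rewrite big_imset /=; last by move=> f h _ _; apply: imset_inj; apply: glue_inj.
congr (_ * _).
  by apply: eq_bigr => f _; rewrite (imset_pi_comp (pi := pi)).
apply: eq_big => [f|f _]; first by rewrite inE.
by rewrite (imset_pi_comp (pi := pi))//; exact: dpi_glue.
Qed.

End Doubling.

(** * Counting *)

Section Terms.
Variables (R : realType) (J V K : finType) (v0 : V) (pi : K -> J).
Variables (c : coloring J V) (x : {ffun J -> V}) (e : {set K}).
Hypotheses (mc : local_coloring c) (einj : {in e &, injective pi}).

Lemma push_sub (f : {set K}) y : f \subset e -> {in pi @: f, push pi e x y =1 push pi f x y}.
Proof.
move=> /subsetP fe _ /imsetP[k kf ->]; rewrite (push_in einj _ _ (fe _ kf)).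
by rewrite push_in// => a b /fe ae /fe be; apply: einj.
Qed.

Lemma color_push_sub (f : {set K}) y : f \subset e ->
  c (pi @: f) (push pi e x y) = c (pi @: f) (push pi f x y).
Proof. by move=> fe; apply: mc; apply: push_sub. Qed.

Lemma proper_imsetP (h : {set J}) : h \proper pi @: e ->
  exists2 f : {set K}, f \proper e & h = pi @: f.
Proof.
move=> he; exists [set k in e | pi k \in h].
  rewrite properE; apply/andP; split; first by apply/subsetP => k; rewrite inE => /andP[].
  have /properP[_ [_ /imsetP[k ke ->] kh]] := he.
  by apply/subsetPn; exists k; rewrite ?inE ?ke.
apply/setP => j; apply/idP/imsetP => [jh|[k]]; last by rewrite inE => /andP[_ ?] ->.
have /imsetP[k ke ej] := subsetP (proper_sub he) _ jh.
by exists k => //; rewrite inE ke -ej.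
Qed.

(** Turns the mass of a label cell into a count for the boundary complex of [e]. *)
Lemma low_label_push y :
  (low_label c (pi @: e) (push pi e x y) == low_label c (pi @: e) x) =
  cell pi c x [set f : {set K} | f \proper e] y.
Proof.
apply/eqP/forall_inP => [ee f|H].
  rewrite inE => fe; have pf : pi @: f \proper pi @: e.
    rewrite properEcard (imsetS _ (proper_sub fe))/= (card_in_imset einj).
    rewrite card_in_imset ?proper_card// => k l kf lf.
    by apply: einj; apply: (subsetP (proper_sub fe)).
  have := congr1 (fun F : {ffun _ -> nat} => F (pi @: f)) ee.
  by rewrite !ffunE pf color_push_sub ?proper_sub// => ->.
apply/ffunP => h; rewrite !ffunE; case: ifP => // /proper_imsetP[f fe ->].
by rewrite color_push_sub ?proper_sub//; apply/eqP/H; rewrite inE.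
Qed.

(* With the coordinates outside [e] fixed, every other edge depends on a proper
   subset of [e] only, so the indicator of the cell is a test as in [regular]. *)
Lemma regular_term (r : {ffun J -> V} -> R) (E : {set {set K}}) eta :
  meas (pi @: e) r -> regular (pi @: e) r eta ->
  (forall f, f \in E -> {in f &, injective pi}) ->
  (forall f, f \in E -> ~~ (e \subset f)) ->
  `|avg (fun y => r (push pi e x y) * indic R (cell pi c x E y))| <= eta.
Proof.
move=> mr reg Einj Ee.
(* The coordinates in [e] are resampled from a fresh [x']. *)
have -> : avg (fun y => r (push pi e x y) * indic R (cell pi c x E y)) =
    avg (fun y => avg (fun x' => r x' * indic R (cell pi c x E (back pi e x' y)))).
  transitivity (avg (fun y => avg (fun _ : {ffun J -> V} =>
      r (push pi e x y) * indic R (cell pi c x E y)))).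
    by apply: eq_avg => y; rewrite (avg_cst x).
  rewrite (avg_swap einj); apply: eq_avg => y; apply: eq_avg => x'.
  congr (_ * _); apply: mr => _ /imsetP[k ke ->].
  by rewrite push_in// ffunE ke.
rewrite -(avg_cst (T := {ffun K -> V}) [ffun=> v0] eta).
apply: le_trans (avg_norm _) _; apply: ler_avg => y.
(* The test for [j] collects the conditions of the faces whose part in [e] avoids [j]. Every face
   misses a vertex of [e], so no condition is lost. *)
pose F j x' := [forall f in E, (j \notin pi @: (f :&: e)) ==>
  (c (pi @: f) (push pi f x (back pi e x' y)) == c (pi @: f) x)].
have -> : avg (fun x' => r x' * indic R (cell pi c x E (back pi e x' y))) =
   avg (fun x' => r x' * indic R [forall j in pi @: e, F j x']).
  apply: eq_avg => x'; congr (_ * indic _ _).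
  apply/forall_inP/forall_inP => [H j jg|H f fE].
    by apply/forall_inP => f fE; rewrite H// implybT.
  have /subsetPn[k ke kf] := Ee _ fE.
  have /forall_inP/(_ f fE)/implyP := H _ (imset_f pi ke); apply.
  apply/negP => /imsetP[l /setIP[lf le] /(einj ke le) kl].
  by rewrite kl lf in kf.
apply: reg => j jg x1 x2 x12; apply: eq_forallb => f.
case: (boolP (f \in E)) => //= fE; case: (boolP (j \notin _)) => //= jf.
congr (_ == _); apply: mc => _ /imsetP[k kf ->].
rewrite !(push_in (Einj f fE))// !ffunE; case: ifP => // ke.
apply: x12; rewrite !inE imset_f// andbT; apply: contraNneq jf => <-.
by rewrite imset_f// inE kf.
Qed.

(** Cauchy-Schwarz over [e]: the first factor is at most [s ^+ 2] times a boundary count, the second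
    is a count in the doubled complex. Both counts are at most twice their weights, and the weights
    multiply to the square of that of [L]. *)
Lemma deviation_term (dl : {set J} -> {ffun J -> V} -> R) (B : {set J} -> {set {ffun J -> V}})
    (L : {set {set K}}) d N (eps s : R) (b : {ffun J -> V} -> R) :
  complex pi L d -> (#|L| <= N)%N -> e \notin L ->
  (forall f : {set K}, f \proper e -> f \in L) ->
  counts d (2 * N) eps c dl B -> eps <= 1 -> 0 <= s ->
  (forall f, f \in L -> x \notin B (pi @: f)) ->
  (forall f, f \in L -> 0 <= dl (pi @: f) x) ->
  meas (pi @: e) b ->
  cexp (low_label c (pi @: e)) (fun z => b z ^+ 2) x <= s ^+ 2 ->
  avg (fun y => `|b (push pi e x y)| * indic R (cell pi c x L y)) <= 2 * s * wt pi dl x L.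
Proof.
move=> cL LN eL pL ctL eps1 s0 LB dl0 mb bs.
set P := [set f : {set K} | f \proper e].
have PL : P \subset L by apply/subsetP => f; rewrite inE => /pL.
have [Lcl Linj Lsz] := cL.
have w0 (A : {set {set K}}) : A \subset L -> 0 <= wt pi dl x A.
  by move=> /subsetP AL; apply: prodr_ge0 => f /AL; apply: dl0.
have cP : complex pi P d.
  split=> [f f'|f|f]; rewrite ?inE.
  - by move=> fe f'f; apply: sub_proper_trans fe.
  - by move=> /pL/Linj.
  - by move=> /pL/Lsz.
have cntP : cnt R pi c x P <= 2 * wt pi dl x P.
  have := ctL x K pi P cP; move=> H; apply: (fun a b h => h (H a b)) => [||].
  - by apply: leq_trans (subset_leq_card PL) _; apply: leq_trans LN _; rewrite leq_pmull.
  - by move=> f /(subsetP PL); apply: LB.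
  move=> /ler_normlP[_]; have := w0 _ PL.
  by move: (cnt _ _ _ _ _) (wt _ _ _ _) => u w w0' h; nra.
(* Inserting the boundary condition is free since [P] is part of [L], and it yields a function of
   the coordinates in [e] with controlled second moment. *)
pose psi y := `|b (push pi e x y)| * indic R (cell pi c x P y).
have -> : avg (fun y => `|b (push pi e x y)| * indic R (cell pi c x L y)) =
    avg (fun y => psi y * indic R (cell pi c x L y)).
  apply: eq_avg => y; rewrite /psi -mulrA -indicM; congr (_ * indic _ _).
  case: (boolP (cell pi c x L y)) => [/forall_inP H|]; last by rewrite andbF.
  by rewrite andbT; apply/esym/forall_inP => f /(subsetP PL); apply: H.
have mpsi : meas e psi.
  move=> y y' yy'; rewrite /psi -!low_label_push.
  have pe : {in pi @: e, push pi e x y =1 push pi e x y'}.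
    by move=> _ /imsetP[k ke ->]; rewrite !push_in// yy'.
  by rewrite (mb _ _ pe) (low_label_meas mc pe).
have psi2 : avg (fun y => psi y ^+ 2) <= s ^+ 2 * (2 * wt pi dl x P).
  have -> : avg (fun y => psi y ^+ 2) = avg (fun z => b z ^+ 2 *
      indic R (low_label c (pi @: e) z == low_label c (pi @: e) x)).
    rewrite -(avg_push einj x v0); last first.
      by move=> z z' zz'; rewrite (mb _ _ zz') (low_label_meas mc zz').
    apply: eq_avg => y; rewrite low_label_push /psi exprMn real_normK ?num_real//.
    by rewrite [indic _ _ ^+ 2]expr2 -indicM andbb.
  rewrite -cexp_cell ler_pM//.
  - by apply: cexp_ge0 => z; apply: sqr_ge0.
  - by apply: avg_ge0 => z; apply: indic_ge0.
  rewrite -(avg_push einj x v0); last first.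
    by move=> z z' zz'; rewrite (low_label_meas mc zz').
  by under eq_avg do rewrite low_label_push.
have dbl : avg (fun z => indic R (cell pi c x L (dbl1 z)) * indic R (cell pi c x L (dbl2 e z)))
   <= 2 * wt (dpi pi) dl x (dcomplex L e).
  have -> : avg (fun z => indic R (cell pi c x L (dbl1 z)) * indic R (cell pi c x L (dbl2 e z))) =
     cnt R (dpi pi) c x (dcomplex L e).
    by apply: eq_avg => z; rewrite -indicM -(cell_dcomplex _ cL).
  have := ctL x _ _ _ (dcomplex_complex e cL); move=> H; apply: (fun a b h => h (H a b)) => [||].
  - by apply: leq_trans (card_dcomplex _ _) _; rewrite leq_mul2l.
  - move=> f' /dcomplexP[f fL [->|->]]; rewrite (imset_pi_comp (pi := pi)) ?LB//.
    exact: dpi_glue.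
  move=> /ler_normlP[_]; have : 0 <= wt (dpi pi) dl x (dcomplex L e).
    by rewrite wt_dcomplex mulr_ge0 ?w0// prodr_ge0// => f /andP[fL _]; apply: dl0.
  by move: (cnt _ _ _ _ _) (wt _ _ _ _) => u w w0' h; nra.
(* The faces of [L] inside [e] are exactly its proper subsets. *)
have wL : wt pi dl x L = wt pi dl x P * \prod_(f in L | ~~ (f \subset e)) dl (pi @: f) x.
  rewrite /wt (bigID (fun f : {set K} => f \subset e)) /=; congr (_ * _).
  apply: eq_bigl => f; rewrite inE properEneq andbC [in RHS]andbC.
  case: (boolP (f \subset e)) => //= fe.
  apply/idP/idP => [fL|fe']; first by apply: contraNneq eL => <-.
  by apply: pL; rewrite properEneq fe' fe.
rewrite -ler_sqr ?nnegrE; last first.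
- by rewrite !mulr_ge0 ?w0.
- by apply: avg_ge0 => y; rewrite !mulr_ge0 ?indic_ge0.
apply: le_trans (avg_CauchySchwarz_dbl _ v0 mpsi) _.
apply: le_trans (ler_pM _ _ psi2 dbl) _.
- by apply: avg_ge0 => y; apply: sqr_ge0.
- by apply: avg_ge0 => z; rewrite mulr_ge0 ?indic_ge0.
rewrite wt_dcomplex wL le_eqVlt; apply/orP; left; apply/eqP.
ring.
Qed.

End Terms.

Section CountingStep.
Variables (R : realType) (J V : finType) (v0 : V).
Variables (c q q' : coloring J V) (dl : {set J} -> {ffun J -> V} -> R).
Variables (B : {set J} -> {set {ffun J -> V}}) (d N : nat) (eps1 s eta : R).
Hypotheses (mc : local_coloring c) (mq : local_coloring q) (mq' : local_coloring q').
Hypotheses (eps1_le1 : eps1 <= 1) (s_ge0 : 0 <= s) (eta_ge0 : 0 <= eta).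
Hypothesis cntd : counts d (2 * N) eps1 c dl B.
Hypothesis qc : forall (h : {set J}) x, #|h| = d -> q h x = c h x.
Hypothesis dl01 : forall (g : {set J}) x, (#|g| <= d.+1)%N -> x \notin B g -> 0 <= dl g x <= 1.
Hypothesis dl_top : forall (g : {set J}) x, #|g| = d.+1 -> x \notin B g ->
  [/\ dl g x = color_den R q c g (c g x) x,
      cexp (low_label c g) (fun z =>
        (color_den R q' c g (c g x) z - color_den R q c g (c g x) z) ^+ 2) x <= s ^+ 2 &
      regular g (fun z => color_ind R c g (c g x) z - color_den R q' c g (c g x) z) eta].

Section Fixed.
Variables (x : {ffun J -> V}) (K : finType) (pi : K -> J).

Definition low (E : {set {set K}}) : {set {set K}} := [set f in E | (#|f| <= d)%N].
Definition top (E : {set {set K}}) : {set {set K}} := [set f in E | #|f| == d.+1].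

(** The indicator of the colour at [e] is the coarse density plus the fine-minus-coarse deviation
    [b] plus the regular part [r]. The density gives the main term; [deviation_term] and
    [regular_term] bound the rest. *)
Lemma remove_edge (E : {set {set K}}) (e : {set K}) :
  complex pi E d.+1 -> (#|E| <= N)%N -> (forall f, f \in E -> x \notin B (pi @: f)) ->
  e \in E -> #|e| = d.+1 ->
  `|cnt R pi c x E - dl (pi @: e) x * cnt R pi c x (E :\ e)|
     <= 2 * s * wt pi dl x (low E) + eta.
Proof.
move=> [cl inj sz] EN EB eE ed.
have einj := inj _ eE.
have ged : #|pi @: e| = d.+1 by rewrite card_in_imset.
set g := pi @: e in ged *; set a := c g x.
have [dlE bs reg] := dl_top ged (EB _ eE).
pose b z := color_den R q' c g a z - color_den R q c g a z.
pose r z := color_ind R c g a z - color_den R q' c g a z.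
have mb : meas g b.
  by move=> z z' zz'; rewrite /b (color_den_meas R c a mq' zz') (color_den_meas R c a mq zz').
have mr : meas g r.
  by move=> z z' zz'; rewrite /r (color_den_meas R c a mq' zz') /color_ind (mc zz').
have EeE : E :\ e \subset E := subD1set _ _.
have LEe : low E \subset E :\ e.
  apply/subsetP => f; rewrite !inE => /andP[-> fd]; rewrite andbT.
  by apply: contraTneq fd => ->; rewrite ed ltnn.
have cL : complex pi (low E) d.
  split=> [f f'|f|f]; rewrite ?inE.
  - move=> /andP[fE fd] ff'; rewrite (cl f)//=.
    exact: leq_trans (subset_leq_card ff') fd.
  - by move=> /andP[/inj].
  - by move=> /andP[].
have cellE y : indic R (cell pi c x E y) =
    indic R (c g (push pi e x y) == a) * indic R (cell pi c x (E :\ e) y).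
  rewrite -indicM; congr indic; apply/forall_inP/andP => [H|[H1 /forall_inP H] f fE].
    by split; [apply: H|apply/forall_inP => f /(subsetP EeE)/H].
  by have [->//|fe] := eqVneq f e; apply: H; rewrite !inE fe.
have -> : cnt R pi c x E - dl g x * cnt R pi c x (E :\ e) =
    avg (fun y => b (push pi e x y) * indic R (cell pi c x (E :\ e) y)) +
    avg (fun y => r (push pi e x y) * indic R (cell pi c x (E :\ e) y)).
  rewrite /cnt -avgZ -avgB -avgD; apply: eq_avg => y; rewrite cellE.
  case: (boolP (cell _ _ _ (E :\ e) y)) => [/forall_inP H|_]; last first.
    by rewrite /indic !mulr0 subr0 addr0.
  (* In the cell, the facets of [e] have the colours of [x]. They have [d] elements, where [q] and
     [c] agree, so the coarse density is the one at [x]. *)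
  have -> : dl g x = color_den R q c g a (push pi e x y).
    rewrite dlE; apply: eq_cexp; apply/ffunP => j; rewrite !ffunE; case: ifP => // /imsetP[k ke ->].
    have ek : g :\ pi k = pi @: (e :\ k).
      apply/setP => i; rewrite !inE; apply/andP/imsetP => [[ik /imsetP[l le ei]]|[l]].
        by exists l => //; rewrite !inE le andbT; apply: contraNneq ik => <-; rewrite ei.
      rewrite !inE => /andP[lk le] ->; split; last exact: imset_f.
      by apply: contraNneq lk => /(einj _ _ le ke) ->.
    have ekd : #|e :\ k| = d by have := cardsD1 k e; rewrite ke ed; case.
    have ekE : e :\ k \in E :\ e.
      rewrite !inE (cl e)// ?subD1set// andbT; apply/eqP => ee.
      by have := ltnSn d; rewrite -{2}ed -ee ekd ltnn.
    have ekd' : #|pi @: (e :\ k)| = d.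
      rewrite card_in_imset// => i l; rewrite !inE => /andP[_ ie] /andP[_ le].
      exact: einj.
    rewrite ek !qc// (color_push_sub x mc einj) ?subD1set//.
    exact/esym/eqP/H.
  rewrite /b /r /color_ind /indic /= !mulr1; ring.
apply: le_trans (ler_normD _ _) _; apply: lerD; last first.
  apply: (regular_term (K := K)) => // f; first by move/(subsetP EeE)/inj.
  rewrite !inE => /andP[fe fE]; apply: contraNN fe => ef; rewrite eq_sym eqEcard ef/= ed.
  exact: sz.
apply: le_trans (avg_norm _) _.
(* As [|b|] is nonnegative, the other top faces may be dropped, so that only faces of size at most
   [d] are doubled. *)
apply: (@le_trans _ _ (avg (fun y => `|b (push pi e x y)| * indic R (cell pi c x (low E) y)))).
  apply: ler_avg => y; rewrite normrM ler_wpM2l// ger0_norm ?indic_ge0//.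
  by apply: ler_indic => /forall_inP H; apply/forall_inP => f /(subsetP LEe); apply: H.
apply: (deviation_term v0 mc einj cL _ _ _ cntd) => //.
- exact: leq_trans (subset_leq_card (subset_trans LEe EeE)) EN.
- by rewrite !inE ed ltnn andbF.
- move=> f fe; rewrite !inE (cl e)// ?proper_sub//=.
  by have := proper_card fe; rewrite ed ltnS.
- by move=> f; rewrite inE => /andP[/EB].
move=> f; rewrite inE => /andP[fE fd]; have fd' : (#|pi @: f| <= d.+1)%N.
  by rewrite card_in_imset ?leqW//; apply: inj.
by case/andP: (dl01 fd' (EB _ fE)).
Qed.

(** Top faces are removed one at a time; their densities are at most 1, so errors add up without
    growing. *)
Lemma peel_top n (E : {set {set K}}) :
  complex pi E d.+1 -> (#|E| <= N)%N -> (forall f, f \in E -> x \notin B (pi @: f)) ->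
  #|top E| = n ->
  `|cnt R pi c x E - wt pi dl x (top E) * cnt R pi c x (low E)|
     <= n%:R * (2 * s * wt pi dl x (low E) + eta).
Proof.
elim: n E => [|n IH] E cE EN EB tn.
  have t0 : top E = set0 by apply/eqP; rewrite -cards_eq0 tn.
  have -> : low E = E.
    apply/setP => f; rewrite !inE; case: (boolP (f \in E)) => //= fE.
    have [_ _ /(_ _ fE)] := cE; rewrite leq_eqVlt => /orP[/eqP fd|//].
    by have /setP/(_ f) := t0; rewrite !inE fE fd eqxx.
  by rewrite t0 /wt big_set0 mul1r subrr normr0 mul0r.
have /set0Pn[e] : top E != set0 by rewrite -cards_eq0 tn.
move=> et; have := et; rewrite inE => /andP[eE /eqP ed].
have tD : top (E :\ e) = top E :\ e by apply/setP => f; rewrite !inE andbA.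
have lD : low (E :\ e) = low E.
  apply/setP => f; rewrite !inE; have [->|//] := eqVneq f e.
  by rewrite ed ltnn !andbF.
have cD : complex pi (E :\ e) d.+1.
  have [cl inj sz] := cE; split=> [f f'|f|f]; rewrite !inE => /andP[fe fE].
  - move=> ff'; rewrite (cl f)// andbT; apply: contraNneq fe => e'; move: ff'; rewrite e' => ef.
    by rewrite eq_sym eqEcard ef ed sz.
  - exact: inj.
  - exact: sz.
have ED : (#|E :\ e| <= #|E|)%N := subset_leq_card (subD1set _ _).
have := IH _ cD (leq_trans ED EN) _ _; rewrite tD lD => H.
have {}H := H (fun f => fun fE => EB f (subsetP (subD1set _ _) f fE)).
have {}H : `|cnt R pi c x (E :\ e) - wt pi dl x (top E :\ e) * cnt R pi c x (low E)|
   <= n%:R * (2 * s * wt pi dl x (low E) + eta).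
  by apply: H; have := cardsD1 e (top E); rewrite et tn; case.
have H1 := remove_edge cE EN EB eE ed.
have wtE : wt pi dl x (top E) = dl (pi @: e) x * wt pi dl x (top E :\ e).
  by rewrite /wt (big_setD1 e).
have /andP[dl0 dl1] : 0 <= dl (pi @: e) x <= 1.
  apply: dl01 (EB _ eE); rewrite card_in_imset ?ed//.
  by have [_ inj _] := cE; apply: inj.
rewrite wtE -natr1 mulrDl mul1r [leRHS]addrC.
move: H H1; set w := wt _ _ _ (top E :\ e); set v := cnt _ _ _ _ (low E).
set u' := cnt R pi c x (E :\ e); set u0 := cnt R pi c x E.
move=> H H1.
have -> : u0 - dl (pi @: e) x * w * v =
  (u0 - dl (pi @: e) x * u') + dl (pi @: e) x * (u' - w * v) by ring.
apply: le_trans (ler_normD _ _) _; apply: lerD => //.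
rewrite normrM ger0_norm//; apply: le_trans H.
by rewrite -[leRHS]mul1r ler_wpM2r.
Qed.

End Fixed.

(** Three errors of [eps / 3]. The deviation error carries the weight of the lower faces, so [s]
    only has to beat [theta ^+ N]; the regularity error is absolute, so [eta] must also beat
    [delta1 ^+ N]. Thus [s] can be fixed before the lower levels are chosen. *)
Lemma counting_step (eps theta delta1 : R) :
  0 < theta <= 1 -> 0 < delta1 <= 1 -> 0 < eps ->
  (forall (g : {set J}) x, #|g| = d.+1 -> x \notin B g -> theta <= dl g x) ->
  (forall (g : {set J}) x, (#|g| <= d)%N -> x \notin B g -> delta1 <= dl g x) ->
  eps1 <= eps / 3 -> N%:R * (2 * s) <= eps / 3 * theta ^+ N ->
  N%:R * eta <= eps / 3 * theta ^+ N * delta1 ^+ N ->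
  counts d.+1 N eps c dl B.
Proof.
move=> /andP[th0 th1] /andP[de0 de1] eps0 dlt dll e1 sN etaN x K pi E cE EN EB.
have [cl inj sz] := cE.
have lowE : low E \subset E by apply/subsetP => f; rewrite inE => /andP[].
have topE : top E \subset E by apply/subsetP => f; rewrite inE => /andP[].
have tN : (#|top E| <= N)%N := leq_trans (subset_leq_card topE) EN.
have lN : (#|low E| <= N)%N := leq_trans (subset_leq_card lowE) EN.
have wprod : wt pi dl x E = wt pi dl x (top E) * wt pi dl x (low E).
  rewrite /wt (bigID (fun f : {set K} => #|f| == d.+1)) /=; congr (_ * _).
    by apply: eq_bigl => f; rewrite inE.
  apply: eq_bigl => f; rewrite inE; case: (boolP (f \in E)) => //= fE.
  by rewrite -ltnS ltn_neqAle sz// andbT.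
have Dge : theta ^+ N <= wt pi dl x (top E).
  apply: (@le_trans _ _ (theta ^+ #|top E|)).
    by apply: ler_wiXn2l => //; apply: ltW.
  rewrite /wt -prodr_const; apply: ler_prod => f ft; rewrite (ltW th0)/=.
  have := ft; rewrite inE => /andP[fE /eqP fd].
  by apply: dlt (EB _ fE); rewrite card_in_imset//; apply: inj.
have Zge : delta1 ^+ N <= wt pi dl x (low E).
  apply: (@le_trans _ _ (delta1 ^+ #|low E|)).
    by apply: ler_wiXn2l => //; apply: ltW.
  rewrite /wt -prodr_const; apply: ler_prod => f ft; rewrite (ltW de0)/=.
  have := ft; rewrite inE => /andP[fE fd].
  by apply: dll (EB _ fE); rewrite card_in_imset//; apply: inj.
have cL : complex pi (low E) d.
  split=> [f f'|f|f]; rewrite ?inE.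
  - move=> /andP[fE fd] ff'; rewrite (cl f)//=.
    exact: leq_trans (subset_leq_card ff') fd.
  - by move=> /andP[/inj].
  - by move=> /andP[].
have H1 : `|cnt R pi c x (low E) - wt pi dl x (low E)| <= eps1 * wt pi dl x (low E).
  apply: cntd => //; first by apply: leq_trans lN _; rewrite leq_pmull.
  by move=> f /(subsetP lowE)/EB.
have H2 := peel_top cE EN EB erefl.
rewrite wprod; move: H1 H2 Dge Zge.
set Z := wt pi dl x (low E); set D := wt pi dl x (top E).
set u := cnt R pi c x E; set v := cnt R pi c x (low E) => H1 H2 Dge Zge.
have D0 : 0 <= D by apply: le_trans Dge; rewrite exprn_ge0// ltW.
have Z0 : 0 <= Z by apply: le_trans Zge; rewrite exprn_ge0// ltW.
have {}H2 : `|u - D * v| <= eps / 3 * (D * Z) + eps / 3 * (D * Z).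
  apply: le_trans H2 _; apply: (@le_trans _ _ (N%:R * (2 * s * Z + eta))).
    by rewrite ler_wpM2r ?ler_nat// addr_ge0// !mulr_ge0.
  rewrite mulrDr; apply: lerD.
    rewrite mulrA (le_trans (ler_wpM2r Z0 sN))// [leRHS]mulrA ler_wpM2r//.
    by rewrite ler_wpM2l// divr_ge0// ltW.
  apply: le_trans etaN _; rewrite -(mulrA (eps / 3)) ler_wpM2l//.
    by rewrite divr_ge0// ltW.
  by apply: ler_pM; rewrite ?exprn_ge0// ltW.
have -> : u - D * Z = (u - D * v) + D * (v - Z) by ring.
apply: le_trans (ler_normD _ _) _.
have H3 : `|D * (v - Z)| <= eps / 3 * (D * Z).
  rewrite normrM ger0_norm// mulrCA ler_wpM2l// (le_trans H1)// ler_wpM2r//.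
lra.
Qed.

End CountingStep.

(** * The regular hierarchy *)

Lemma counts_ext (R : realType) (J V : finType) d N (eps : R) (c c' : coloring J V)
    (dl dl' : {set J} -> {ffun J -> V} -> R) (B B' : {set J} -> {set {ffun J -> V}}) :
  (forall g : {set J}, (#|g| <= d)%N -> [/\ c g = c' g, dl g = dl' g & B g = B' g]) ->
  counts d N eps c dl B -> counts d N eps c' dl' B'.
Proof.
move=> ext H x K pi E cE EN EB; have [_ inj sz] := cE.
have fd f : f \in E -> (#|pi @: f| <= d)%N.
  by move=> fE; rewrite card_in_imset ?sz//; apply: inj.
have -> : wt pi dl' x E = wt pi dl x E.
  by apply: eq_bigr => f fE; have [_ -> _] := ext _ (fd f fE).
have -> : cnt R pi c' x E = cnt R pi c x E.
  apply: eq_avg => y; congr indic; apply: eq_forallb => f.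
  case: (boolP (f \in E)) => //= fE; by have [-> _ _] := ext _ (fd f fE).
by apply: H => // f fE; have [_ _ ->] := ext _ (fd f fE); apply: EB.
Qed.

(** For each colour, the points that have it in cells where its density is below [theta] have mass
    at most [theta]; sum over the colours. *)
Lemma avg_low_density (R : realType) (T : finType) (L : eqType) (l : T -> L)
    (col : T -> nat) (m : nat) (theta : R) : 0 <= theta ->
  (forall x, (col x < m)%N) ->
  avg (fun x => indic R (cexp l (fun y => indic R (col y == col x)) x < theta))
    <= m%:R * theta.
Proof.
move=> th0 cm.
pose p a := cexp l (fun y => indic R (col y == a)).
apply: (@le_trans _ _ (avg (fun x => \sum_(a < m) indic R (col x == a) * indic R (p a x < theta)))).
  apply: ler_avg => x; rewrite (bigD1 (Ordinal (cm x)))//= eqxx mul1r lerDl.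
  by apply: sumr_ge0 => a _; rewrite mulr_ge0 ?indic_ge0.
rewrite avg_sum -[m%:R]mulr_natl mulr1 -[m in leRHS]card_ord mulr_natl -sumr_const.
apply: ler_sum => a _.
rewrite -(avg_cexp (l := l)) => [|x y e]; last by rewrite /p (eq_cexp _ e).
have [x0 _|T0] := pickP T; last by rewrite /avg big1 ?mul0r// => x; have := T0 x.
rewrite -[leRHS](avg_cst x0); apply: ler_avg => x.
rewrite -/(p a); case: ltP => [lt|_]; first by rewrite mulr1 ltW.
by rewrite mulr0.
Qed.

(** Markov's inequality for each colour, summed over the colours. *)
Lemma avg_large_deviation (R : realType) (T : finType) (L : eqType) (l : T -> L)
    (col : T -> nat) (m : nat) (F : nat -> T -> R) (s tau : R) : 0 < s -> 0 <= tau ->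
  (forall x, (col x < m)%N) -> (forall a x, 0 <= F a x) ->
  (forall a : 'I_m, avg (F a) <= tau) ->
  avg (fun x => indic R (s < cexp l (F (col x)) x)) <= m%:R * (tau / s).
Proof.
move=> s0 tau0 cm F0 Ft.
apply: (@le_trans _ _ (avg (fun x => \sum_(a < m) s^-1 * cexp l (F a) x))).
  apply: ler_avg => x; rewrite (bigD1 (Ordinal (cm x)))//=.
  apply: ler_wpDr.
    by apply: sumr_ge0 => a _; rewrite mulr_ge0 ?cexp_ge0 ?invr_ge0 ?ltW.
  case: ltP => [lt|_]; last by rewrite mulr_ge0 ?cexp_ge0 ?invr_ge0 ?ltW.
  by rewrite /indic ler_pdivlMl// mulr1 ltW.
rewrite avg_sum -[m in leRHS]card_ord mulr_natl -sumr_const.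
apply: ler_sum => a _; rewrite avgZ avg_cexp1 mulrC; apply: ler_wpM2r; last exact: Ft.
by rewrite invr_ge0 ltW.
Qed.

Lemma min_positive (R : realType) (f : nat -> R) (n : nat) :
  (forall i, 0 < f i) -> exists2 delta, 0 < delta & forall i, (i <= n)%N -> delta <= f i.
Proof.
move=> f0; elim: n => [|n [delta d0 H]].
  by exists (f 0%N) => // i; rewrite leqn0 => /eqP ->.
exists (Num.min delta (f n.+1)); first by rewrite lt_min d0 f0.
move=> i; rewrite leq_eqVlt => /orP[/eqP ->|]; first by rewrite ge_min lexx orbT.
by rewrite ltnS => /H; rewrite ge_min => ->.
Qed.

(** The colours [c0] are prescribed on sets of size [d], those on smaller sets are to be found.
    [eps] bounds both the mass of bad sets and the counting error. *)
Definition hierarchy (R : realType) (J V : finType) (d N : nat) (eps delta : R)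
    (c0 c : coloring J V) (dl : {set J} -> {ffun J -> V} -> R)
    (B : {set J} -> {set {ffun J -> V}}) : Prop :=
  [/\ local_coloring c,
      forall (g : {set J}) x, #|g| = d -> c g x = c0 g x,
      forall g, meas g (fun x => x \in B g) /\ avg (fun x => indic R (x \in B g)) <= eps,
      forall (g : {set J}) x, (#|g| <= d)%N -> x \notin B g -> delta <= dl g x <= 1 &
      counts d N eps c dl B].

(** Regularize the top colours; the coarse partition [q] becomes the prescribed colouring one level
    down, with [2 * N] faces to allow for doubling. *)
Lemma hierarchy_exists (R : realType) (J : finType) (d m N : nat) (eps : R) : 0 < eps ->
  exists2 delta : R, 0 < delta <= 1 &
  forall (V : finType) (v0 : V) (c0 : coloring J V),
    local_coloring c0 -> color_bound c0 m ->
    exists c dl B, hierarchy d N eps delta c0 c dl B.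
Proof.
elim: d m N eps => [|d IH] m N eps eps0.
  (* At level 0 the only possible face is the empty set, whose colour is constant by locality, so
     all counts are exactly 1. *)
  exists 1; first by rewrite ltr01 lexx.
  move=> V v0 c0 mc0 c0m; exists c0, (fun _ _ => 1), (fun _ => set0); split=> //.
  - move=> g; split; first by move=> x y _; rewrite !inE.
    rewrite -(avg_cst [ffun _ : J => v0] eps); apply: ler_avg => x.
    by rewrite inE ltW.
  - by move=> *; rewrite lexx.
  move=> x K pi E [_ _ sz] _ _; rewrite /wt big1// mulr1.
  have -> : cnt R pi c0 x E = 1.
    rewrite -[RHS](avg_cst [ffun _ : K => v0]); apply: eq_avg => y.
    rewrite (_ : cell _ _ _ _ _ = true)//; apply/forall_inP => f /sz.
    rewrite leqn0 cards_eq0 => /eqP ->; rewrite imset0; apply/eqP; apply: mc0 => j.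
    by rewrite inE.
  by rewrite subrr normr0 ltW.
pose e := Num.min eps 1.
have e0 : 0 < e by rewrite lt_min eps0 ltr01.
have e1 : e <= 1 by rewrite ge_min lexx orbT.
have ee : e <= eps by rewrite ge_min lexx.
have N0 : 0 < N.+1%:R :> R by rewrite ltr0n.
have m0 : 0 < m.+1%:R :> R by rewrite ltr0n.
have m1 : 1 <= m.+1%:R :> R by rewrite ler1n.
(* Sparse and deviant points get mass at most [m * theta] and [m * (tau / s ^+ 2)], each at most
   [eps / 2]; [s] is small enough for [counting_step]. Successors avoid division by zero. *)
pose theta := e / (2 * m.+1%:R).
have th0 : 0 < theta by rewrite divr_gt0// mulr_gt0.
have th1 : theta <= 1 by rewrite /theta ler_pdivrMr ?mulr_gt0// mul1r; lra.
pose s := eps * theta ^+ N / (6 * N.+1%:R).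
have s0 : 0 < s by rewrite divr_gt0 ?mulr_gt0// exprn_gt0.
pose tau := s ^+ 2 * (eps / (2 * m.+1%:R)).
have tau0 : 0 < tau by rewrite mulr_gt0 ?exprn_gt0// divr_gt0// mulr_gt0.
have e30 : 0 < e / 3 by rewrite divr_gt0.
(* The density bound one level down depends on the number [M] of colours of [q], and [eta M] has to
   beat its [N]-th power. *)
have /choice[del Hdel] : forall M, exists del : R, 0 < del <= 1 /\
  forall (V : finType) (v0 : V) (c0 : coloring J V),
    local_coloring c0 -> color_bound c0 M ->
    exists c dl B, hierarchy d (2 * N) (e / 3) del c0 c dl B.
  by move=> M; have [del H1 H2] := IH M (2 * N)%N _ e30; exists del.
pose eta M := eps / 3 * theta ^+ N * del M ^+ N / N.+1%:R.
have eta0 M : 0 < eta M.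
  have [/andP[dM _] _] := Hdel M.
  by rewrite divr_gt0// !mulr_gt0 ?exprn_gt0// invr_gt0.
have [Mmax SR] := @strong_regularity R J m tau eta tau0 eta0.
(* As [M] is at most [Mmax], a minimum over finitely many values makes the bound uniform. *)
have [|dmin dmin0 dminle] := @min_positive R del Mmax.
  by move=> M; have [/andP[]] := Hdel M.
exists (Num.min theta dmin).
  by rewrite lt_min th0 dmin0 ge_min th1.
move=> V v0 c0 mc0 c0m.
have [M [q [q' [MM mq qM mq' SRq]]]] := SR V c0.
have [/andP[dM0 dM1] HM] := Hdel M.
have [c1 [dl1 [B1 [mc1 c1q B1P dl1P cnt1]]]] := HM V v0 q mq qM.
pose c : coloring J V := fun g => if #|g| == d.+1 then c0 g else c1 g.
pose dev (g : {set J}) a z : R := (color_den R q' c g a z - color_den R q c g a z) ^+ 2.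
pose dl (g : {set J}) x := if #|g| == d.+1 then color_den R q c g (c g x) x else dl1 g x.
pose Btop (g : {set J}) : {set {ffun J -> V}} :=
  [set x | (color_den R q c g (c g x) x < theta)
         || (s ^+ 2 < cexp (low_label c g) (dev g (c g x)) x)].
pose B (g : {set J}) := if #|g| == d.+1 then Btop g else B1 g.
have mc : local_coloring c.
  by move=> g; rewrite /c; case: ifP => _; [apply: mc0|apply: mc1].
have cm (g : {set J}) x : #|g| = d.+1 -> (c g x < m)%N.
  by move=> gd; rewrite /c gd eqxx.
have denE (g : {set J}) q2 a : #|g| = d.+1 -> color_den R q2 c g a = color_den R q2 c0 g a.
  by move=> gd; rewrite /color_den /color_ind /c gd eqxx.
have low_ext (g : {set J}) : (#|g| <= d)%N ->
    [/\ c1 g = c g, dl1 g = dl g & B1 g = B g].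
  by move=> gd; rewrite /c /dl /B; rewrite (ltn_eqF (gd : #|g| < d.+1)%N).
exists c, dl, B; split=> //.
- by move=> g x gd; rewrite /c gd eqxx.
- move=> g; rewrite /B; case: ifP => [/eqP gd|_]; last first.
    have [mB1 B1e] := B1P g; split=> //; apply: le_trans B1e _.
    by apply: le_trans ee; rewrite ler_pdivrMr// ler_peMr ?ler1n// ltW.
  split.
    move=> x y xy; rewrite !inE (mc g x y xy) (color_den_meas R c _ mq xy).
    by rewrite (eq_cexp _ (low_label_meas mc xy)).
  apply: (@le_trans _ _ (m%:R * theta + m%:R * (tau / s ^+ 2))).
    apply: (@le_trans _ _ (avg (fun x => indic R (color_den R q c g (c g x) x < theta) +
        indic R (s ^+ 2 < cexp (low_label c g) (dev g (c g x)) x)))).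
      apply: ler_avg => x; rewrite inE.
      by case: (_ < theta); case: (_ < _); rewrite /indic /= ?addr0 ?add0r//; lra.
    rewrite avgD lerD//.
      by apply: avg_low_density; rewrite ?ltW// => x; apply: cm.
    apply: (@avg_large_deviation _ _ _ _ (c g) m (dev g)); rewrite ?exprn_gt0 ?ltW//.
    - by move=> x; apply: cm.
    - by move=> a x; apply: sqr_ge0.
    by move=> a; rewrite /dev !denE//; have [] := SRq g a.
  have -> : tau / s ^+ 2 = eps / (2 * m.+1%:R).
    by rewrite /tau mulrAC divff ?mul1r// expf_neq0// gt_eqF.
  apply: (@le_trans _ _ (m.+1%:R * (eps / (2 * m.+1%:R)) + m.+1%:R * (eps / (2 * m.+1%:R)))).
    apply: lerD; apply: ler_pM => //; rewrite ?ler_nat//.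
    - exact: ltW.
    - by rewrite ler_wpM2r// invr_ge0 ltW// mulr_gt0.
    - by rewrite ltW// divr_gt0// mulr_gt0.
  rewrite le_eqVlt; apply/orP; left; apply/eqP.
  by move: (m.+1%:R) m0 => k k0; field; rewrite gt_eqF.
- move=> g x gd; rewrite /dl /B; case: ifP => [/eqP ge|/eqP ge].
    rewrite inE negb_or -!leNgt => /andP[H _].
    by rewrite ge_min H/= color_den_le1.
  move=> xB; have gd' : (#|g| <= d)%N by move: gd; rewrite leq_eqVlt => /orP[/eqP//|].
  have /andP[H1 H2] := dl1P _ _ gd' xB.
  by rewrite H2 ge_min (le_trans (dminle _ MM) H1) orbT.
have dl_top (g : {set J}) x : #|g| = d.+1 -> x \notin B g -> theta <= dl g x.
  by move=> gd; rewrite /B /dl gd eqxx inE negb_or -!leNgt => /andP[].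
have dl_low (g : {set J}) x : (#|g| <= d)%N -> x \notin B g -> del M <= dl g x <= 1.
  by move=> gd; have [_ <- <-] := low_ext _ gd; apply: dl1P.
have e13 : e / 3 <= 1 by rewrite ler_pdivrMr// mul1r; lra.
apply: (@counting_step R J V v0 c q q' dl B d N (e / 3) s (eta M) mc mq mq' e13
  (ltW s0) (ltW (eta0 M)) _ _ _ _ eps theta (del M)); rewrite ?th0 ?dM0//.
- exact: counts_ext cnt1.
- by move=> h x hd; rewrite /c ifN ?c1q// hd neq_ltn ltnSn.
- move=> g x gd xB; move: gd; rewrite leq_eqVlt => /orP[/eqP gd|gd].
    rewrite (le_trans _ (dl_top _ _ gd xB)) ?(ltW th0)//=.
    by rewrite /dl gd eqxx color_den_le1.
  have /andP[H1 ->] := dl_low _ _ gd xB.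
  by rewrite (le_trans _ H1)// ltW.
- move=> g x gd xB; split; first by rewrite /dl gd eqxx.
    by move: xB; rewrite /B gd eqxx inE negb_or -!leNgt => /andP[].
  have [_] := SRq g (Ordinal (cm _ x gd)).
  by rewrite /= denE// /color_ind /c gd eqxx.
- by move=> g x gd xB; have /andP[] := dl_low _ _ gd xB.
- by rewrite ler_wpM2r ?invr_ge0.
- have -> : N%:R * (2 * s) = (N%:R / N.+1%:R) * (eps / 3 * theta ^+ N).
    by rewrite /s; move: (N.+1%:R) N0 => k k0; field; rewrite gt_eqF.
  apply: ler_piMl; last by rewrite ler_pdivrMr// mul1r ler_nat.
  apply/ltW/mulr_gt0; [exact: divr_gt0|exact: exprn_gt0].
- rewrite /eta mulrCA; apply: ler_piMr; last by rewrite ler_pdivrMr// mul1r ler_nat.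
  by rewrite ltW// mulr_gt0 ?exprn_gt0// mulr_gt0 ?exprn_gt0// divr_gt0.
Qed.

(** * Removal *)

Lemma sum_indic (R : realType) (T : finType) (P : pred T) :
  \sum_x indic R (P x) = #|P|%:R.
Proof.
rewrite -sum1_card natr_sum [RHS]big_mkcond /=; apply: eq_bigr => x _.
by rewrite unfold_in; case: (P x).
Qed.

Lemma hom_densityE (R : realType) k (V W : finType) (F : {set k.-tuple V})
    (G : {set k.-tuple W}) :
  hom_density R F G = avg (fun f : {ffun V -> W} => indic R (dhom F G f)).
Proof.
rewrite /hom_density /avg sum_indic; congr (_%:R / _).
by apply: eq_card => f; rewrite inE.
Qed.

Lemma hom_density_eq0 (R : realType) k (V W : finType) (F : {set k.-tuple V})
    (G : {set k.-tuple W}) :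
  (forall f : {ffun V -> W}, ~~ dhom F G f) -> hom_density R F G = 0.
Proof.
move=> H; rewrite hom_densityE /avg big1 ?mul0r// => f _.
by rewrite /indic (negPf (H f)).
Qed.

Lemma map_tuple_eq_in k (V W : finType) (a : k.-tuple V) (x y : V -> W) :
  {in a, x =1 y} -> map_tuple x a = map_tuple y a.
Proof. by move=> xy; apply: val_inj; apply/eq_in_map. Qed.

(** Both the image tuple and membership in [A] are read off from the coordinates in [a], so the
    images inject into the maps from ['I_k] whose push lies in [A]; these have the density of
    [A]. *)
Lemma card_local_image (R : realType) (k : nat) (J V : finType) (v0 : V)
    (a : k.-tuple J) (A : {set {ffun J -> V}}) (h : {set J}) :
  uniq a -> h \subset [set j in a] -> meas h (fun x => x \in A) ->
  #|[set map_tuple x a | x : {ffun J -> V} in A]|%:R <=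
    avg (fun x => indic R (x \in A)) * #|V|%:R ^+ k.
Proof.
move=> ua /subsetP ha mA.
have inj : {in [set: 'I_k] &, injective (tnth a)}.
  by move=> i j _ _; apply/tuple_uniqP.
have im : tnth a @: [set: 'I_k] = [set j in a].
  apply/setP => j; rewrite inE; apply/imsetP/tnthP => [[i _ ->]|[i ->]]; exists i => //.
pose x0 : {ffun J -> V} := [ffun=> v0].
rewrite -(avg_push inj x0 v0); last first.
  by move=> x y xy; rewrite (mA x y)// => j /ha; rewrite -im; apply: xy.
rewrite /avg (sum_indic R (fun y => push (tnth a) [set: 'I_k] x0 y \in A)).
rewrite card_ffun card_ord natrX divfK; last first.
  by rewrite expf_neq0// pnatr_eq0 -lt0n; apply/card_gt0P; exists v0.
rewrite ler_nat.
pose tof (e : k.-tuple V) : {ffun 'I_k -> V} := [ffun i => tnth e i].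
have tofI : injective tof.
  move=> e e' /ffunP ee; apply: eq_from_tnth => i.
  by have := ee i; rewrite !ffunE.
rewrite -(card_imset _ tofI); apply: subset_leq_card; apply/subsetP => y.
case/imsetP => _ /imsetP[x xA ->] ->; rewrite unfold_in.
rewrite (mA _ x)// => j /ha; rewrite -im => /imsetP[i _ ->].
by rewrite push_in ?inE// ffunE tnth_map.
Qed.

Lemma card_bigcup_le (I U : finType) (P : pred I) (A : I -> {set U}) :
  (#|\bigcup_(i | P i) A i| <= \sum_(i | P i) #|A i|)%N.
Proof.
elim/big_rec2: _ => [|i s X _ IH]; first by rewrite cards0.
by apply: leq_trans (leq_card_setU _ _) _; rewrite leq_add2l.
Qed.

Lemma removal_lemma (R : realType) (k : nat) (eps : R) (VF : finType)
    (F : {set k.-tuple VF}) : 0 < eps -> dhypergraph F ->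
  exists2 delta : R, 0 < delta & forall (VG : finType) (v0 : VG) (G : {set k.-tuple VG}),
    hom_density R F G <= delta ->
    exists S : {set k.-tuple VG}, [/\ S \subset G, #|S|%:R <= eps * #|VG|%:R ^+ k &
      forall f : {ffun VF -> VG}, ~~ dhom F (G :\: S) f].
Proof.
have absurd_bounds (u w D ew : R) : 0 < D -> D <= w -> u <= D / 4 ->
    ew <= 2^-1 * w -> - (u - w) <= ew -> False by lra.
move=> eps0 uF; pose n := (#|F| * #|{: {set VF}}|).+1.
have n0 : 0 < n%:R :> R by rewrite ltr0n.
pose e := Num.min (eps / n%:R) 2^-1.
have e0 : 0 < e by rewrite lt_min divr_gt0// invr_gt0 ltr0n.
have e_half : e <= 2^-1 by rewrite ge_min lexx orbT.
have en : e <= eps / n%:R by rewrite ge_min lexx.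
pose N := #|{: {set VF}}|.
have [de /andP[de0 de1] H] := @hierarchy_exists R VF k #|{: {set k.-tuple VF}}| N e e0.
have dN : 0 < de ^+ N by rewrite exprn_gt0.
exists (de ^+ N / 4); first by rewrite divr_gt0.
move=> VG v0 G dens.
pose edges (g : {set VF}) (x : {ffun VF -> VG}) : {set k.-tuple VF} :=
  [set a in F | ([set j in a] == g) && (map_tuple x a \in G)].
pose c0 : coloring VF VG := fun g x => enum_rank (edges g x).
have mc0 : local_coloring c0.
  move=> g x y xy; rewrite /c0; congr (nat_of_ord (enum_rank _)).
  apply/setP => a; rewrite !inE; case: eqP => //= ag.
  rewrite (@map_tuple_eq_in _ _ _ a x y)// => j ja; apply: xy.
  by rewrite -ag inE.
have c0m : color_bound c0 #|{: {set k.-tuple VF}}| by move=> g x; apply: ltn_ord.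
have [c [dl [B [mc cc0 BP dlP cntP]]]] := H VG v0 c0 mc0 c0m.
(* An edge is removed if it is the image of some [a] under a point that is bad for a subset of
   [a]. *)
pose T (a : k.-tuple VF) (h : {set VF}) := [set map_tuple x a | x : {ffun VF -> VG} in B h].
pose S := G :&: \bigcup_(a in F) \bigcup_(h : {set VF} | h \subset [set j in a]) T a h.
exists S; split; first exact: subsetIl.
  have le1 : (#|S| <= \sum_(a in F) \sum_(h : {set VF} | h \subset [set j in a]) #|T a h|)%N.
    apply: leq_trans (subset_leq_card (subsetIr _ _)) _.
    apply: leq_trans (card_bigcup_le _ _) _; apply: leq_sum => a _.
    exact: card_bigcup_le.
  apply: (@le_trans _ _ ((\sum_(a in F) \sum_(h : {set VF} | h \subset [set j in a]) #|T a h|)%:R)).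
    by rewrite ler_nat.
  have V0 : 0 <= #|VG|%:R ^+ k :> R by rewrite exprn_ge0.
  apply: (@le_trans _ _ (\sum_(a in F) \sum_(h : {set VF}) e * #|VG|%:R ^+ k)).
    rewrite natr_sum; apply: ler_sum => a aF; rewrite natr_sum big_mkcond /=.
    apply: ler_sum => h _; case: ifP => ha; last by rewrite mulr_ge0// ltW.
    have [mB Be] := BP h.
    apply: le_trans (card_local_image R v0 (uF _ aF) ha mB) _.
    by rewrite ler_wpM2r.
  rewrite !sumr_const -mulrnA -[leLHS]mulr_natl mulrA ler_wpM2r//.
  apply: (@le_trans _ _ (n%:R * e)).
    by rewrite ler_wpM2r ?(ltW e0)// ler_nat /n mulnC leqW.
  by rewrite mulrC -ler_pdivlMr.
move=> f; apply/negP => /forall_inP homf.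
have fG a : a \in F -> map_tuple f a \in G.
  by move=> /homf; rewrite inE => /andP[].
have fB a (h : {set VF}) : a \in F -> h \subset [set j in a] -> f \notin B h.
  move=> aF ha; have := homf _ aF; rewrite !inE => /andP[+ fg].
  apply: contraNN => fBh; rewrite fg /=; apply/bigcupP; exists a => //.
  by apply/bigcupP; exists h => //; apply/imsetP; exists f.
(* The downward closure of the edges of [F]; a surviving copy [f] is bad for none of its faces. *)
pose E : {set {set VF}} := [set h : {set VF} | [exists a in F, h \subset [set j in a]]].
have cE : complex id E k.
  split=> [h h'|h _ //|h]; rewrite ?inE.
  - case/exists_inP => a aF ha h'h; apply/exists_inP; exists a => //.
    exact: subset_trans ha.
  - case/exists_inP => a aF /subset_leq_card/leq_trans; apply.
    by rewrite cardsE (leq_trans (card_size _))// size_tuple.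
have EB h : h \in E -> f \notin B [set id j | j in h].
  by rewrite imset_id inE => /exists_inP[a aF ha]; apply: fB ha.
have := cntP f _ _ _ cE (max_card _) EB.
have wtge : de ^+ N <= wt id dl f E.
  apply: (@le_trans _ _ (de ^+ #|E|)).
    by apply: ler_wiXn2l; rewrite ?max_card// ltW.
  rewrite /wt -prodr_const; apply: ler_prod => h hE; rewrite (ltW de0)/=.
  have hk : (#|[set id j | j in h]| <= k)%N.
    by rewrite imset_id; have [_ _] := cE; apply.
  by case/andP: (dlP _ _ hk (EB _ hE)).
(* A point with the colours of [f] maps the same edges of [F] into [G] as [f] does, namely all of
   them. The cell of [f] thus consists of copies of [F]. *)
have cntle : cnt R id c f E <= de ^+ N / 4.
  apply: le_trans dens; rewrite hom_densityE; apply: ler_avg => y.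
  apply: ler_indic => /forall_inP Hc; apply/forall_inP => a aF.
  pose g := [set j in a].
  have gE : g \in E by rewrite inE; apply/exists_inP; exists a.
  have gk : #|g| = k by rewrite cardsE; have /card_uniqP := uF _ aF; rewrite size_tuple.
  have := Hc _ gE; rewrite imset_id => /eqP.
  rewrite (mc g _ y); last first.
    by move=> j jg; rewrite -[j in LHS]/(id j) push_in.
  rewrite !cc0// /c0 => /ord_inj/enum_rank_inj/setP/(_ a).
  by rewrite !inE aF eqxx fG//= => ->.
have w0 : 0 <= wt id dl f E by apply: le_trans wtge; apply: ltW.
have ew := ler_wpM2r w0 e_half.
by move=> /ler_normlP[wu _]; exact: absurd_bounds dN wtge cntle ew wu.
Qed.

(** * Symmetrization under the automorphism group *)

Lemma symmetrize (k : nat) (VF VG : finType) (F : {set k.-tuple VF})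
    (G S : {set k.-tuple VG}) :
  (forall f : {ffun VF -> VG}, ~~ dhom F (G :\: S) f) ->
  exists S' : {set k.-tuple VG}, [/\ S' \subset G, (#|S'| <= #|F| * #|S|)%N,
    forall f : {ffun VF -> VG}, ~~ dhom F (G :\: S') f &
    dhAut G \subset dhAut (G :\: S')].
Proof.
move=> noF; pose A := dhAut G.
have A0 : (0 < #|A|)%N := cardG_gt0 (dhAut_group G).
have AG s e : s \in A -> e \in G -> map_tuple s e \in G.
  by rewrite inE => /forall_inP H; apply: H.
(* The proportion of [occ e] in [A] is the proportion of the orbit of [e] that lies in [S]. *)
pose occ e := [set s in A | map_tuple s e \in S].
pose S' := [set e in G | (#|A| <= #|F| * #|occ e|)%N].
exists S'; split.
- by apply/subsetP => e; rewrite inE => /andP[].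
(* Count pairs of an automorphism and a tuple that it carries into [S]: there are at most
   [#|A| * #|S|], and each element of [S'] lies in at least [#|A| / #|F|]. *)
- rewrite -(leq_pmul2r A0).
  apply: (@leq_trans (\sum_(e : k.-tuple VG) #|F| * #|occ e|)%N).
    rewrite -sum_nat_const big_mkcond /=; apply: leq_sum => e _.
    by rewrite inE; case: ifP => // /andP[].
  rewrite -big_distrr -mulnA leq_mul2l; apply/orP; right.
  have -> : (\sum_e #|occ e| = \sum_(s in A) #|[set e : k.-tuple VG | map_tuple s e \in S]|)%N.
    transitivity (\sum_e \sum_(s in A | map_tuple s e \in S) 1)%N.
      by apply: eq_bigr => e _; rewrite sum1dep_card; apply: eq_card => s; rewrite !inE.
    rewrite (exchange_big_dep (mem A)) /=; last by move=> e s _ /andP[].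
    by apply: eq_bigr => s sA; rewrite sA sum1dep_card.
  rewrite mulnC -sum_nat_const; apply: leq_sum => s _.
  have sI : injective (map_tuple s : k.-tuple VG -> k.-tuple VG).
    by move=> e e' /(congr1 val) /(inj_map perm_inj) /val_inj.
  rewrite -(card_imset _ sI); apply: subset_leq_card; apply/subsetP => _ /imsetP[e + ->].
  by rewrite inE.
- move=> f; apply/negP => /forall_inP homf.
  (* Otherwise the sets [occ] of the edges of the copy cover [A], although each is smaller than
     [#|A| / #|F|]. For empty [F] the cover is empty, while [A] is not. *)
  have [s sA sf] : exists2 s, s \in A & forall a, a \in F -> map_tuple s (map_tuple f a) \notin S.
    have [/subsetPn[s sA sU]|] := boolP (~~ (A \subset \bigcup_(a in F) occ (map_tuple f a))).
      exists s => // a aF; apply: contraNN sU => H.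
      by apply/bigcupP; exists a => //; rewrite inE sA.
    rewrite negbK => /subset_leq_card/leq_trans/(_ (card_bigcup_le _ _)) leA.
    have [F0|/set0Pn[a0 a0F]] := eqVneq F set0.
      by move: leA; rewrite F0 big_set0 leqNgt A0.
    have lt a : a \in F -> (#|F| * #|occ (map_tuple f a)| < #|A|)%N.
      by move=> /homf; rewrite !inE => /andP[+ faG]; rewrite faG ltnNge.
    suff : (#|F| * #|A| < #|F| * #|A|)%N by rewrite ltnn.
    apply: (@leq_ltn_trans (\sum_(a in F) #|F| * #|occ (map_tuple f a)|)%N).
      by rewrite -big_distrr leq_mul2l leA orbT.
    rewrite -sum_nat_const (bigD1 a0)//= [ltnRHS](bigD1 a0)//= -addSn.
    by apply: leq_add; [exact: lt|apply: leq_sum => a /andP[/lt/ltnW]].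
  have /negP[] := noF [ffun j => s (f j)]; apply/forall_inP => a aF.
  have -> : map_tuple [ffun j => s (f j)] a = map_tuple s (map_tuple f a).
    by apply: val_inj; rewrite /= -map_comp; apply: eq_map => j; rewrite /= ffunE.
  rewrite inE sf//= AG//.
  by have := homf _ aF; rewrite inE => /andP[].
apply/subsetP => t tA; rewrite inE; apply/forall_inP => e.
rewrite !inE => /andP[+ eG]; rewrite eG (AG t e tA eG) /= andbT -!ltnNge.
apply: leq_ltn_trans; rewrite leq_mul2l; apply/orP; right.
(* Left multiplication by [t] injects [occ] of the translate into [occ e], as products of
   permutations act from left to right. *)
rewrite -(card_imset _ (mulgI t)); apply: subset_leq_card; apply/subsetP => _ /imsetP[s + ->].
rewrite !inE => /andP[sA sS]; apply/andP; split.
  by have := groupM (tA : t \in dhAut_group G) (_ : s \in dhAut_group G); rewrite !inE; apply.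
suff -> : map_tuple (t * s)%g e = map_tuple s (map_tuple t e) by [].
by apply: val_inj; rewrite /= -map_comp; apply: eq_map => j; rewrite /= permM.
Qed.

(** A map into an empty type is the only one, so if it is a homomorphism the density is 1. *)
Lemma hom_density_void (R : realType) k (V W : finType) (F : {set k.-tuple V})
    (G : {set k.-tuple W}) : #|W| = 0%N -> hom_density R F G < 1 -> hom_density R F G = 0.
Proof.
move=> W0 lt; apply: hom_density_eq0 => f; apply/negP => homf.
have W1 : W -> False by move=> w; have := fintype0 w W0.
move: lt; rewrite hom_densityE ltNge => /negP[]; rewrite -[leLHS](avg_cst f).
apply: ler_avg => f'; rewrite (_ : f' = f) ?homf//.
by apply/ffunP => v; case: (W1 (f v)).
Qed.

Theorem theorem2 (R : realType) (k : nat) (eps : R) (VF : finType)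
    (F : {set k.-tuple VF}) (eps_gt0 : 0 < eps) (hF : dhypergraph F) :
  exists delta : R, 0 < delta /\
    forall (VG : finType) (G : {set k.-tuple VG}),
      dhypergraph G ->
      hom_density R F G <= delta ->
      exists S : {set k.-tuple VG},
        [/\ S \subset G,
            #|S|%:R <= eps * #|VG|%:R ^+ k,
            hom_density R F (G :\: S) = 0 &
            dhAut G \subset dhAut (G :\: S)].
Proof.
(* Symmetrization enlarges [S] by a factor [#|F|], so [eps] is divided in advance; the successor
   covers empty [F]. *)
have n0 : 0 < #|F|.+1%:R :> R by rewrite ltr0n.
have [delta d0 H] := removal_lemma (divr_gt0 eps_gt0 n0) hF.
(* Any bound below 1 settles graphs without vertices through [hom_density_void]. *)
exists (Num.min delta 2^-1); split; first by rewrite lt_min d0 invr_gt0 ltr0n.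
move=> VG G _; rewrite le_min => /andP[dens half].
have [W0|/card_gt0P[v0 _]] := posnP #|VG|.
  exists set0; rewrite setD0; split; rewrite ?sub0set ?subxx//.
    by rewrite cards0 mulr_ge0 ?exprn_ge0// ltW.
  by apply: hom_density_void => //; apply: le_lt_trans half _; rewrite invf_lt1 ?ltr1n.
have [S [SG Sc noF]] := H VG v0 G dens.
have [S' [S'G S'c noF' AutS']] := symmetrize noF.
exists S'; split=> //; last exact: hom_density_eq0.
apply: (@le_trans _ _ (#|F|.+1%:R * #|S|%:R)).
  by rewrite -natrM ler_nat (leq_trans S'c)// leq_mul2r leqnSn orbT.
by rewrite mulrC -ler_pdivlMr// mulrAC.
Qed.
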